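(* Let $b\ge2$ be an integer, $0<\alpha<\tfrac12$, and let $\Phi=\Phi^{\alpha,b}_{\mathcal{G}}\colon\mathbb{S}^1\to\mathbb{R}^d$ be an $\alpha$-bi-Hölder Weierstrass embedding. Let $W\in\mathcal{W}^{\alpha,b}$. Then for $\mathcal{L}^d$-almost every $\mathbf{t}\in\mathbb{R}^d$, the occupation measure $\lambda_{\mathbf{t}}=(W_{\mathbf{t}})_*\mathcal{L}^1$ of $W_{\mathbf{t}}(x)=W(x)+\langle\mathbf{t},\Phi(x)\rangle$ is absolutely continuous with respect to Lebesgue measure, with a bounded and continuous density.
   Context: $\mathbb{S}^1$ is identified with $\mathbb{R}/\mathbb{Z}$, i.e. with $[0,1)$ carrying Lebesgue measure $\mathcal{L}^1$. For an integer $b\ge2$, $0<\alpha<1$ and a Lipschitz $g\colon\mathbb{S}^1\to\mathbb{R}$, $W_g^{\alpha,b}(x)=\sum_{k=0}^\infty b^{-\alpha k}g(b^kx)$; $\mathcal{W}^{\alpha,b}$ is the family of all such functions. For $\mathcal{G}=\{g_0,\dots,g_{d-1}\}$ Lipschitz on $\mathbb{S}^1$, $\Phi^{\alpha,b}_{\mathcal{G}}(x)=(W^{\alpha,b}_{g_0}(x),\dots,W^{\alpha,b}_{g_{d-1}}(x))$. $\Phi$ is $\alpha$-bi-Hölder if $c_1|x-y|^\alpha\le\|\Phi(x)-\Phi(y)\|\le c_2|x-y|^\alpha$ for all $x,y$, with constants $c_1,c_2>0$ and $\|\cdot\|$ the $\ell^\infty$ norm. *)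

(* Defs.v *)
From HB Require Import structures.
From mathcomp Require Import all_boot all_order all_algebra.
From mathcomp Require Import all_classical all_reals all_analysis.
Set Implicit Arguments. Unset Strict Implicit. Unset Printing Implicit Defensive.
Import Order.TTheory GRing.Theory Num.Theory.
Import numFieldNormedType.Exports.
Local Open Scope classical_set_scope.
Local Open Scope ring_scope.

(* Functions on S^1 = R/Z are represented as 1-periodic functions R -> R. *)
Definition one_periodic {R : realType} (g : R -> R) : Prop :=
  forall x, g (x + 1) = g x.

Definition fracpart {R : realType} (x : R) : R := x - (Num.floor x)%:~R.
Definition circ_dist {R : realType} (x y : R) : R :=
  Num.min (fracpart (x - y)) (1 - fracpart (x - y)).

Definition weierstrass {R : realType} (alpha : R) (b : nat) (g : R -> R) (x : R) : R :=
  limn (fun n : nat =>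
    \sum_(0 <= k < n) ((b%:R : R) `^ (- (alpha * k%:R)) * g ((b%:R : R) ^+ k * x))).

Definition weierstrass_map {R : realType} (alpha : R) (b d : nat)
  (G : 'I_d -> R -> R) (x : R) : 'I_d -> R :=
  fun i => weierstrass alpha b (G i) x.

Definition sup_norm {R : realType} (d : nat) (v : 'I_d -> R) : R :=
  \big[Num.max/0]_(i < d) `|v i|.

Definition bi_holder {R : realType} (alpha : R) (d : nat) (Phi : R -> 'I_d -> R) : Prop :=
  exists c1 c2 : R, 0 < c1 /\ 0 < c2 /\
    forall x y : R,
      c1 * circ_dist x y `^ alpha <= sup_norm (fun i => Phi x i - Phi y i) /\
      sup_norm (fun i => Phi x i - Phi y i) <= c2 * circ_dist x y `^ alpha.

Definition box {R : realType} (d : nat) (a c : 'I_d -> R) : set ('I_d -> R) :=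
  [set t | forall i, a i <= t i <= c i].
Definition box_vol {R : realType} (d : nat) (a c : 'I_d -> R) : R :=
  \prod_(i < d) (c i - a i).

Definition lebesgue_null {R : realType} (d : nat) (N : set ('I_d -> R)) : Prop :=
  forall eps : R, 0 < eps ->
    exists (a c : nat -> 'I_d -> R),
      (forall n i, a n i <= c n i) /\
      N `<=` \bigcup_n box (a n) (c n) /\
      forall m, \sum_(0 <= n < m) box_vol (a n) (c n) <= eps.

Definition occupation {R : realType} (f : R -> R) (A : set R) : \bar R :=
  (@lebesgue_measure R) ([set x | `[0%R, 1%R[%classic x /\ A (f x)]).

Definition has_bdd_cont_density {R : realType} (f : R -> R) : Prop :=
  exists rho : R -> R,
    continuous rho /\ (forall y, 0 <= rho y) /\ (exists M : R, forall y, rho y <= M) /\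
    forall A : set R, measurable A ->
      occupation f A = (\int[@lebesgue_measure R]_(y in A) (rho y)%:E)%E.

(* Main.v *)
Require Import Defs.
From HB Require Import structures.
From mathcomp Require Import all_boot all_order all_algebra.
From mathcomp Require Import all_classical all_reals all_analysis.
From mathcomp Require Import measurable_realfun complex.
From mathcomp Require Import ring lra zify.
Set Implicit Arguments. Unset Strict Implicit. Unset Printing Implicit Defensive.
Import Order.TTheory GRing.Theory Num.Theory.
Import numFieldNormedType.Exports.
Local Open Scope classical_set_scope.
Local Open Scope ring_scope.

(** Work with the Fourier coefficients of the occupation measure of [W_t] at the
   frequencies [k / L]. Their squared modulus is a double integral of
   [cos (k / L * (W_t x - W_t y))], in which [t] enters linearly with coefficient
   [Phi x - Phi y], a vector of sup norm at least [c1 |x - y|^alpha]. Averaging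
   over a fine grid of parameters [t], weighted like an [r]-fold convolution of
   uniform distributions, a product of geometric sums bounds the average by
   [(C / (k |x - y|^alpha))^r]. Splitting the double integral at
   [|x - y| = k^(-q)] with [2 < q < 1 / alpha] and [r] large, the mean squared
   coefficient is [O(k^(-q))]; this is where [alpha < 1/2] is needed. By Markov's
   inequality on dyadic blocks of frequencies and Borel-Cantelli, the Fourier
   coefficients are absolutely summable for almost every [t]; the exceptional
   sets are covered by grid cells, so that no measure on R^d is needed. Fejer's
   theorem then identifies the sum of the Fourier series, a bounded continuous
   function, as the density. *)

(** * Exponential sums over grids *)

(** The two bounds on [q] have opposite origins. A dyadic block has [2^n] frequencies; mean squares
    of order [2^(-qn)] and Cauchy-Schwarz bound the sum of the moduli by about [2^(n(1 - q/2))],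
    which is summable only for [q > 2]. In the far part [k |x - y|^alpha] is at least
    [k^(1 - alpha q)], and this has to grow, hence [q < 1 / alpha]; the power [r] then makes any
    such growth beat [k^(-q)]. A plain uniform average would give one power only, which is why the
    weights are an iterated convolution. The frequencies [k / L] belong to the period [2 pi L]. If
    the values of [W_t] lie in [[-L/2, L/2]], one period contains them with room to spare, but such
    an [L] depends on [t]; the exceptional set therefore has to serve all positive integers [L] at
    once. A finite grid sees only its own points. The energies are Lipschitz in [t], so a mesh that
    is fine enough, of a size depending on the block, passes from a corner to its whole cell. *)

Section TrigonometricBounds.
Variable R : realType.
Implicit Types (x y u v : R).
Import Normc.

Lemma sin_le_id x : 0 <= x -> sin x <= x.
Proof.
move=> x0; have [|y _] := @MVT_segment R sin cos 0 x x0 (fun y _ => is_derive_sin y).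
  exact/continuous_subspaceT/continuous_sin.
by rewrite sin0 !subr0 => ->; rewrite ler_piMl// cos_le1.
Qed.

(** The derivative is [cos y = 1 - 2 sin(y/2)^2], and [sin(y/2) <= 1/2] on this range keeps it at
    least [1/2]. *)
Lemma sin_ge_half x : 0 <= x <= 1 -> x / 2 <= sin x.
Proof.
move=> /andP[x0 x1].
have [|y] := @MVT_segment R sin cos 0 x x0 (fun y _ => is_derive_sin y).
  exact/continuous_subspaceT/continuous_sin.
rewrite in_itv /= sin0 !subr0 => /andP[y0 yx] ->.
rewrite mulrC ler_wpM2r//.
have -> : y = (y / 2) *+ 2 by rewrite -mulr_natr divfK.
rewrite cos_mulr2n cos2sin2.
have h0 : 0 <= sin (y / 2).
  by apply: sin_ge0_pi; have := @pi_ge2 R; lra.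
have h1 : sin (y / 2) <= y / 2 by apply: sin_le_id; lra.
have : sin (y / 2) ^+ 2 <= (1 / 2) ^+ 2.
  by rewrite lerXn2r ?nnegrE//; lra.
lra.
Qed.

Lemma sqr_sin_ge x : `|x| <= 1 -> x ^+ 2 / 4 <= sin x ^+ 2.
Proof.
wlog x0 : x / 0 <= x => [hw|].
  have [/hw//|x0] := leP 0 x.
  by rewrite -normrN => /hw; rewrite sinN !sqrrN; apply; lra.
rewrite ger0_norm// => x1; have := @sin_ge_half x; rewrite x0 x1 => /(_ isT) h.
have -> : x ^+ 2 / 4 = (x / 2) ^+ 2 by field.
by rewrite lerXn2r ?nnegrE//; lra.
Qed.

Definition cis x : R[i] := Complex (cos x) (sin x).

Lemma cisD x y : cis (x + y) = cis x * cis y.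
Proof. by rewrite /cis cosD sinD; simpc; congr Complex; ring. Qed.

Lemma cis0 : cis 0 = 1.
Proof. by rewrite /cis cos0 sin0. Qed.

Lemma cis_sum (I : finType) (F : I -> R) : cis (\sum_i F i) = \prod_i cis (F i).
Proof. by apply: (big_morph cis cisD cis0). Qed.

Lemma normc_ge0 (z : R[i]) : 0 <= normc z.
Proof. by case: z => x y; exact: sqrtr_ge0. Qed.

Lemma normc_cis x : normc (cis x) = 1.
Proof. by rewrite /cis /= cos2Dsin2 sqrtr1. Qed.

Lemma normc_sum (I : finType) (F : I -> R[i]) :
  normc (\sum_i F i) <= \sum_i normc (F i).
Proof.
elim/big_ind2: _ => [|x1 x2 y1 y2 h1 h2|//]; first by rewrite normc0.
by rewrite (le_trans (le_normcD _ _))// lerD.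
Qed.

(** The modulus equals [2 |sin(x/2)|], and [|x/2| <= 1] is the range of the quadratic lower bound on
    [sin^2]. *)
Lemma normc_cisB1 x : `|x| <= 2 -> `|x| / 2 <= normc (cis x - 1).
Proof.
move=> x2; have -> : `|x| / 2 = Num.sqrt ((x / 2) ^+ 2).
  by rewrite sqrtr_sqr normrM [`|_^-1|]ger0_norm.
rewrite /cis; simpc => /=; rewrite ler_wsqrtr//.
have c : cos x = 1 - 2 * sin (x / 2) ^+ 2.
  rewrite [in LHS](_ : x = (x / 2) *+ 2); last by rewrite -mulr_natr divfK.
  by rewrite cos_mulr2n cos2sin2; ring.
have := @sqr_sin_ge (x / 2); have := cos2Dsin2 x.
rewrite normrM [`|2^-1|]ger0_norm// sqrrB1 c.
by move=> h1 h2; have := h2; lra.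
Qed.

Lemma normc_geometric_cis_le_card (m : nat) x :
  normc (\sum_(j < m) cis (j%:R * x)) <= m%:R.
Proof.
rewrite (le_trans (normc_sum _))//.
by under eq_bigr do rewrite normc_cis; rewrite sumr_const card_ord.
Qed.

(** Multiplication by [cis x - 1] telescopes the sum to [cis (m x) - 1], of modulus at most 2. The
    bound is free of [m]; this is the source of all cancellation. *)
Lemma normc_geometric_cis_le (m : nat) x : `|x| <= 2 -> x != 0 ->
  normc (\sum_(j < m) cis (j%:R * x)) <= 4 / `|x|.
Proof.
move=> x2 x0.
have e : (cis x - 1) * \sum_(j < m) cis (j%:R * x) = cis (m%:R * x) - 1.
  rewrite big_distrr/= -[in RHS]cis0 -[X in _ - cis X](mul0r x).
  rewrite -(telescope_sumr (fun j => cis (j%:R * x)) (leq0n m)).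
  rewrite big_mkord; apply: eq_bigr => j _; by rewrite -natr1 [(_ + 1) * x]mulrDl mul1r cisD; ring.
have xp : 0 < `|x| by rewrite normr_gt0.
have h : normc (cis x - 1) * normc (\sum_(j < m) cis (j%:R * x)) <= 2.
  rewrite -normcM e (le_trans (le_normcD _ _))// normcN normc_cis.
  by rewrite normc1.
rewrite ler_pdivlMr//.
have := normc_cisB1 x2; move: h.
have : 0 <= normc (\sum_(j < m) cis (j%:R * x)) by exact: normc_ge0.
set s := normc _; set t := normc _; move=> s0 h1 h2.
have : `|x| / 2 * s <= t * s by rewrite ler_wpM2r.
lra.
Qed.

End TrigonometricBounds.

Section GridAverage.
Variables (R : realType) (d r M : nat).
Import Normc.

(* A grid step is a sum of [r] uniform steps of length [< M] and one of length
   [< (r+1)M]: the first ones give decay of order [r] of the exponential sums,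
   the last one makes the steps cover [[rM, (r+1)M)] uniformly. *)
Definition steps : finType := ('I_(r.+1 * M) * {ffun 'I_r -> 'I_M})%type.
Definition step_sum (k : steps) : nat := (k.1 + \sum_l k.2 l)%N.

Lemma card_steps : #|{: steps}| = (r.+1 * M * M ^ r)%N.
Proof. by rewrite card_prod card_ffun !card_ord. Qed.

(** The exponential sum of a convolution is the product of the exponential sums. *)
Lemma cis_step_sum (x : R) : \sum_(k : steps) cis ((step_sum k)%:R * x) =
  (\sum_(j < r.+1 * M) cis (j%:R * x)) * (\sum_(j < M) cis (j%:R * x)) ^+ r.
Proof.
rewrite -[X in _ ^+ X](card_ord r) -prodr_const.
rewrite (bigA_distr_bigA (fun=> fun j : 'I_M => cis (j%:R * x))).
rewrite big_distrlr/= pair_big/=; apply: (eq_bigr (fun k : steps => _)) => -[j f] _ /=.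
rewrite /step_sum/= natrD mulrDl cisD natr_sum mulr_suml cis_sum.
by congr (_ * _).
Qed.

(** The sum is the real part of a product over the coordinates. Only [i0] provides decay: each of
    its [r] short factors is at most [4 M / |v i0|], and the powers of [M] recombine with the
    trivially bounded long factor into the number of steps. The bound [2 M] on [|v i0|] keeps the
    phase increment [v i0 / M] in the range of the geometric sum estimate, away from aliasing. *)
Lemma grid_sum_cos_le (a : R) (v : 'I_d -> R) (i0 : 'I_d) : (0 < M)%N ->
  v i0 != 0 -> `|v i0| <= 2 * M%:R ->
  \sum_(f : {ffun 'I_d -> steps}) cos (a + \sum_i (step_sum (f i))%:R / M%:R * v i)
  <= (#|{: steps}| ^ d)%:R * (4 / `|v i0|) ^+ r.
Proof.
move=> M0 v0 v2.
have Mp : 0 < M%:R :> R by rewrite ltr0n.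
pose z := \sum_(f : {ffun 'I_d -> steps})
  cis (a + \sum_i (step_sum (f i))%:R / M%:R * v i).
have -> : \sum_(f : {ffun 'I_d -> steps})
  cos (a + \sum_i (step_sum (f i))%:R / M%:R * v i) = complex.Re z.
  by rewrite /z; elim/big_rec2: _ => [//|f [x y] u _ ->].
apply: (@le_trans _ _ (normc z)).
  case: z => x y /=; rewrite (le_trans (ler_norm x))// -sqrtr_sqr.
  by rewrite ler_wsqrtr// lerDl sqr_ge0.
have -> : z = cis a * \prod_i \sum_(k : steps) cis ((step_sum k)%:R * (v i / M%:R)).
  rewrite bigA_distr_bigA big_distrr/=; apply: eq_bigr => f _.
  rewrite cisD cis_sum; congr (_ * _); apply: eq_bigr => i _.
  by rewrite mulrAC mulrA.
rewrite normcM normc_cis mul1r.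
rewrite (_ : normc _ = \prod_i normc (\sum_(k : steps) cis ((step_sum k)%:R * (v i / M%:R)))); last first.
  by apply: big_morph; [exact: normcM|exact: normc1].
have hle i : normc (\sum_(k : steps) cis ((step_sum k)%:R * (v i / M%:R))) <= #|{: steps}|%:R.
  rewrite (le_trans (normc_sum _))//.
  by under eq_bigr do rewrite normc_cis; rewrite sumr_const.
have cd : 0 <= #|{: steps}|%:R :> R by [].
have -> : (#|{: steps}| ^ d)%:R = \prod_(i < d) #|{: steps}|%:R :> R.
  by rewrite prodr_const card_ord natrX.
rewrite (bigD1 i0)//= [X in _ <= X * _](bigD1 i0)//= mulrAC ler_pM//.
- exact: normc_ge0.
- by apply: prodr_ge0 => i _; exact: normc_ge0.
- rewrite cis_step_sum normcM card_steps natrM -mulrA ler_pM ?normc_ge0//.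
    exact: normc_geometric_cis_le_card.
  have -> : forall w : R[i], normc (w ^+ r) = normc w ^+ r.
    by move=> w; elim: r => [|n IH]; rewrite ?expr0 ?normc1// !exprS normcM IH.
  rewrite natrX -exprMn lerXn2r ?nnegrE ?normc_ge0 ?mulr_ge0//.
  rewrite (le_trans (normc_geometric_cis_le _ _ _))//.
  + by rewrite normrM normfV (ger0_norm (ltW Mp)) ler_pdivrMr.
  + by rewrite mulf_neq0// invr_neq0// gt_eqF.
  + rewrite normrM normfV (ger0_norm (ltW Mp)) invfM invrK.
    by rewrite le_eqVlt; apply/orP; left; apply/eqP; ring.
- by apply: ler_prod => i _; rewrite hle andbT normc_ge0.
Qed.

End GridAverage.

(** * Coverings by boxes *)

Section BoxCoverings.
Variables (R : realType) (d : nat).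
Hypothesis d_gt0 : (0 < d)%N.
Implicit Types (N : set ('I_d -> R)) (v w : R).

(** [lebesgue_null N] is [covered N eps] for all positive [eps]; an explicit volume is what Markov's
    inequality delivers and Borel-Cantelli sums. *)
Definition covered N v := exists (a c : nat -> 'I_d -> R),
  (forall n i, a n i <= c n i) /\
  N `<=` \bigcup_n box (a n) (c n) /\
  forall m, \sum_(0 <= n < m) box_vol (a n) (c n) <= v.

Lemma coveredW N N' v v' : N `<=` N' -> v' <= v -> covered N' v' -> covered N v.
Proof.
move=> NN' vv' [a [c [ac [Nac h]]]]; exists a, c; split => //; split.
  exact: subset_trans Nac.
by move=> m; rewrite (le_trans (h m)).
Qed.

Lemma box_vol_ge0 (a c : 'I_d -> R) : (forall i, a i <= c i) -> 0 <= box_vol a c.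
Proof. by move=> ac; apply: prodr_ge0 => i _; rewrite subr_ge0. Qed.

(** Degenerate boxes pad finite covers to sequences. Positive dimension matters: an empty product
    would give volume 1. *)
Lemma box_vol_cst (a : 'I_d -> R) : box_vol a a = 0.
Proof.
rewrite /box_vol (bigD1 (Ordinal d_gt0))//= subrr mul0r //.
Qed.

Lemma covered_box (a c : 'I_d -> R) : (forall i, a i <= c i) ->
  covered (box a c) (box_vol a c).
Proof.
move=> ac; exists (fun n => if n == 0%N then a else cst 0),
  (fun n => if n == 0%N then c else cst 0); split; last split.
- by case=> //= n i.
- by move=> t act; exists 0%N.
- case=> [|m]; first by rewrite big_geq// box_vol_ge0.
  rewrite big_nat_recl//= big1_seq ?addr0// => n _.
  exact: box_vol_cst.
Qed.

Lemma covered0 : covered set0 0.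
Proof.
apply: coveredW (covered_box (fun i => lexx (cst 0 i))) => //.
by rewrite box_vol_cst.
Qed.

(** The boxes of all covers are enumerated by coding pairs; an index that codes no pair gets a
    degenerate box. *)
Lemma covered_bigcup (N : nat -> set ('I_d -> R)) (v : nat -> R) V :
  (forall n, covered (N n) (v n)) -> (forall m, \sum_(0 <= n < m) v n <= V) ->
  covered (\bigcup_n N n) V.
Proof.
move=> /choice[a] /choice[c] h vV.
pose code_inv n := @pickle_inv (nat * nat)%type n.
pose A n : 'I_d -> R := if code_inv n is Some p then a p.1 p.2 else cst 0.
pose C n : 'I_d -> R := if code_inv n is Some p then c p.1 p.2 else cst 0.
have AC n i : A n i <= C n i.
  by rewrite /A /C; case: (code_inv n) => [[j k]|//] /=; have [] := h j.
exists A, C; split => //; split.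
  move=> t [j _ Njt]; have [_ [/(_ _ Njt)[k _ ajk] _]] := h j.
  by exists (pickle (j, k)) => //; rewrite /A /C /code_inv pickleK_inv.
move=> m.
(* Every pair decoded from some [n < m] has both entries below [K], so the first [m] boxes come from
   a [K] by [K] square, whose rows are controlled by the given covers. *)
pose K := \sum_(0 <= n < m) (if code_inv n is Some p then (p.1 + p.2).+1 else 0)%N.
pose vol j k := box_vol (a j k) (c j k).
have vol0 j k : 0 <= vol j k by apply: box_vol_ge0; have [] := h j.
apply: (@le_trans _ _ (\sum_(0 <= n < m) \sum_(0 <= j < K) \sum_(0 <= k < K)
    (pickle (j, k) == n)%:R * vol j k)).
  rewrite big_nat [leRHS]big_nat; apply: ler_sum => n /andP[_ nm].
  have t0 j k : 0 <= (pickle (j, k) == n)%:R * vol j k by rewrite mulr_ge0.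
  case E : (code_inv n) => [[j k]|]; last first.
    rewrite /A /C E box_vol_cst; apply: sumr_ge0 => j _.
    by apply: sumr_ge0 => k _.
  have jk : ((j + k).+1 <= K)%N.
    by rewrite /K big_mkord (bigD1 (Ordinal nm))//= E leq_addr.
  have En : pickle (j, k) = n.
    by have := @pickle_invK (nat * nat)%type n; rewrite /oapp -/(code_inv n) E.
  rewrite /A /C E /= -/(vol j k) !big_mkord.
  have jK : (j < K)%N by rewrite (leq_trans _ jk)// ltnS leq_addr.
  have kK : (k < K)%N by rewrite (leq_trans _ jk)// ltnS leq_addl.
  rewrite (bigD1 (Ordinal jK))//= big_mkord (bigD1 (Ordinal kK))//= En eqxx mul1r.
  rewrite -addrA lerDl addr_ge0//; first by apply: sumr_ge0.
  by apply: sumr_ge0 => j' _; apply: sumr_ge0.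
rewrite exchange_big/=; apply: (le_trans _ (vV K)); apply: ler_sum => j _.
rewrite exchange_big/=; have [_ [_ hj]] := h j; apply: (le_trans _ (hj K)).
apply: ler_sum => k _; rewrite -mulr_suml ler_piMl ?vol0//.
rewrite -natr_sum -[leRHS]/(1%N%:R) ler_nat.
have [lt|ge] := ltnP (pickle (j, k)) m; last first.
  rewrite big_nat big1// => n /andP[_ nm].
  by case: eqP => // E; move: ge; rewrite E leqNgt nm.
rewrite big_mkord (bigD1 (Ordinal lt))//= eqxx big1// => n.
by rewrite -val_eqE/= eq_sym => /negbTE ->.
Qed.

Lemma covered_finite N (I : finType) (P : pred I) (a c : I -> 'I_d -> R) w :
  0 <= w -> (forall k i, a k i <= c k i) -> (forall k, box_vol (a k) (c k) <= w) ->
  (forall t, N t -> exists2 k, P k & box (a k) (c k) t) ->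
  covered N (#|P|%:R * w).
Proof.
move=> w0 ac vw NP.
pose B n : set ('I_d -> R) := if insub n is Some o
   then box (a (enum_val (o : 'I_#|P|))) (c (enum_val o)) else set0.
apply: (@coveredW _ (\bigcup_n B n) _ _ _ (lexx _)) => [t /NP[k Pk kt]|].
  exists (enum_rank_in Pk k) => //; rewrite /B valK enum_rankK_in//.
apply: (@covered_bigcup _ (fun n => if (n < #|P|)%N then w else 0)).
  move=> n; rewrite /B; case: insubP => [k kP _|/negbTE ->]; last exact: covered0.
  by rewrite kP; exact: (coveredW (@subset_refl _ _) (vw _) (covered_box (ac _))).
move=> m; rewrite -big_mkcond/= big_const_seq iter_addr_0 -[w *+ _]mulr_natl.
rewrite ler_wpM2r// ler_nat -size_filter -[leqRHS](size_iota 0).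
apply: uniq_leq_size => [|k]; first by rewrite filter_uniq// iota_uniq.
by rewrite mem_filter mem_iota => /andP[].
Qed.

Lemma geometric_sum_le (x : R) m : 0 <= x < 1 ->
  \sum_(0 <= n < m) x ^+ n <= (1 - x)^-1.
Proof.
move=> /andP[x0 x1]; rewrite -[leRHS]mul1r ler_pdivlMr ?subr_gt0// mulrC.
by rewrite big_mkord -opprB mulNr -subrX1 opprB gerBl exprn_ge0.
Qed.

Lemma null_bigcup (N : nat -> set ('I_d -> R)) :
  (forall n, lebesgue_null (N n)) -> lebesgue_null (\bigcup_n N n).
Proof.
move=> N0 eps eps0.
apply: (@covered_bigcup N (fun n => eps / 2 * 2^-1 ^+ n)).
  by move=> n; apply: N0; rewrite !mulr_gt0// exprn_gt0.
move=> m; rewrite -mulr_sumr.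
have := @geometric_sum_le 2^-1 m; rewrite invr_ge0 ler0n invf_lt1 ?ltr1n// => /(_ isT) h.
apply: (le_trans (ler_wpM2l _ h)); first by rewrite ltW ?divr_gt0.
by rewrite le_eqVlt; apply/orP; left; apply/eqP; field.
Qed.

(** Borel-Cantelli: [N] lies in every tail union of the [B n], and tails of a geometric series are
    arbitrarily small. *)
Lemma null_limsup N (B : nat -> set ('I_d -> R)) (C x : R) : 0 <= x < 1 -> 0 <= C ->
  (forall n, covered (B n) (C * x ^+ n)) ->
  (forall t, N t -> forall n0, exists2 n, (n0 <= n)%N & B n t) -> lebesgue_null N.
Proof.
move=> x01 C0 hB NB eps eps0; have /andP[x0 x1] := x01.
have y0 : 0 < 1 - x by rewrite subr_gt0.
have [n0 hn0] : exists n0, C * x ^+ n0 * (1 - x)^-1 <= eps.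
  have : C * x ^+ n * (1 - x)^-1 @[n --> \oo] --> C * 0 * (1 - x)^-1.
    apply: cvgMl; apply: cvgMr; apply: cvg_expr.
    by rewrite ger0_norm.
  rewrite mulr0 mul0r => /cvgrPdist_le /(_ _ eps0)[n0 _ /(_ n0 (leqnn _))].
  by rewrite sub0r normrN => h; exists n0; rewrite (le_trans (ler_norm _)).
apply: (@coveredW _ (\bigcup_n B (n0 + n)%N) _ _ _ (lexx _)).
  move=> t /NB /(_ n0)[n n0n Bn]; exists (n - n0)%N => //.
  by rewrite subnKC.
apply: (@covered_bigcup _ (fun n => C * x ^+ (n0 + n))) => // m.
under eq_bigr do rewrite exprD mulrA.
rewrite -mulr_sumr (le_trans _ hn0)// ler_wpM2l ?geometric_sum_le//.
by rewrite mulr_ge0// exprn_ge0.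
Qed.

End BoxCoverings.

(** * Means over the circle *)

Section Mean.
Variable R : realType.
Implicit Types (f g : R -> R) (x y r C : R).
Notation mu := (@lebesgue_measure R).

Definition mean f : R := \int[mu]_(x in `[0, 1[) f x.

Definition bounded_measurable f :=
  measurable_fun setT f /\ exists C, forall x, `|f x| <= C.

Lemma bounded_measurable_integrable f (a b : R) : bounded_measurable f ->
  mu.-integrable `[a, b[ (EFin \o f).
Proof.
move=> [mf [C fC]]; apply: measurable_bounded_integrable => //.
- have : (mu `[a, b[%classic < +oo)%E; last by [].
  by rewrite lebesgue_measure_itv/=; case: ifP => _; rewrite ?ltry// -EFinD ltry.
- exact: measurable_funTS.
- exists C; split; first exact: num_real.
  by move=> y Cy x _ /=; rewrite (le_trans (fC x))// ltW.
Qed.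

Lemma bounded_measurable_cst r : bounded_measurable (cst r).
Proof. by split; [exact: measurable_cst|exists `|r|]. Qed.

Lemma bounded_measurableD f g : bounded_measurable f -> bounded_measurable g ->
  bounded_measurable (fun x => f x + g x).
Proof.
move=> [mf [C fC]] [mg [C' gC]]; split; first exact: measurable_funD.
by exists (C + C') => x; rewrite (le_trans (ler_normD _ _))// lerD.
Qed.

Lemma bounded_measurableM f g : bounded_measurable f -> bounded_measurable g ->
  bounded_measurable (fun x => f x * g x).
Proof.
move=> [mf [C fC]] [mg [C' gC]]; split; first exact: measurable_funM.
by exists (C * C') => x; rewrite normrM ler_pM.
Qed.

Lemma bounded_measurableZ r f : bounded_measurable f ->
  bounded_measurable (fun x => r * f x).
Proof. exact/bounded_measurableM/bounded_measurable_cst. Qed.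

Lemma bounded_measurable_sum (I : Type) (s : seq I) (P : pred I) (F : I -> R -> R) :
  (forall i, bounded_measurable (F i)) ->
  bounded_measurable (fun x => \sum_(i <- s | P i) F i x).
Proof.
move=> h; elim: s => [|i s IH].
  under eq_fun do rewrite big_nil; exact: bounded_measurable_cst.
under eq_fun do rewrite big_cons; case: (P i) => //.
exact: bounded_measurableD.
Qed.

Lemma bounded_measurable_cos f : measurable_fun setT f ->
  bounded_measurable (fun x => cos (f x)).
Proof.
move=> mf; split; last by exists 1 => x; exact: cos_max.
by apply: measurableT_comp => //; apply: continuous_measurable_fun; exact: continuous_cos.
Qed.

Lemma bounded_measurable_sin f : measurable_fun setT f ->
  bounded_measurable (fun x => sin (f x)).
Proof.
move=> mf; split; last by exists 1 => x; exact: sin_max.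
by apply: measurableT_comp => //; apply: continuous_measurable_fun; exact: continuous_sin.
Qed.

Lemma mean_cst r : mean (cst r) = r.
Proof.
by rewrite /mean Rintegral_cst//= lebesgue_measure_itv/= lte01 oppr0 adde0 mulr1.
Qed.

Lemma meanD f g : bounded_measurable f -> bounded_measurable g ->
  mean (fun x => f x + g x) = mean f + mean g.
Proof.
by move=> bf bg; rewrite /mean RintegralD//; exact: bounded_measurable_integrable.
Qed.

Lemma meanZ r f : bounded_measurable f -> mean (fun x => r * f x) = r * mean f.
Proof.
by move=> bf; rewrite /mean RintegralZl//; exact: bounded_measurable_integrable.
Qed.

Lemma mean_sum (I : Type) (s : seq I) (P : pred I) (F : I -> R -> R) :
  (forall i, bounded_measurable (F i)) ->
  mean (fun x => \sum_(i <- s | P i) F i x) = \sum_(i <- s | P i) mean (F i).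
Proof.
move=> h; elim: s => [|i s IH].
  by rewrite big_nil; under eq_fun do rewrite big_nil; exact: mean_cst.
rewrite big_cons; under eq_fun do rewrite big_cons; case: (P i) => //.
by rewrite meanD ?IH//; exact: bounded_measurable_sum.
Qed.

Lemma le_mean f g : bounded_measurable f -> bounded_measurable g ->
  (forall x, 0 <= x < 1 -> f x <= g x) -> mean f <= mean g.
Proof.
move=> bf bg fg; apply: le_Rintegral => //; try exact: bounded_measurable_integrable.
Qed.

Lemma mean_le f C : bounded_measurable f -> (forall x, 0 <= x < 1 -> f x <= C) ->
  mean f <= C.
Proof.
move=> bf fC; rewrite -[leRHS]mean_cst; apply: le_mean => //.
exact: bounded_measurable_cst.
Qed.

Lemma norm_mean_le f C : bounded_measurable f -> (forall x, `|f x| <= C) ->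
  `|mean f| <= C.
Proof.
move=> bf fC; rewrite ler_norml mean_le//; last first.
  by move=> x _; rewrite (le_trans (ler_norm _)).
rewrite andbT -[leLHS]mean_cst; apply: le_mean => //.
  exact: bounded_measurable_cst.
by move=> x _ /=; rewrite lerNl (le_trans (ler_norm _))// normrN.
Qed.

Lemma norm_meanB_le f g C : bounded_measurable f -> bounded_measurable g ->
  (forall x, `|f x - g x| <= C) -> `|mean f - mean g| <= C.
Proof.
move=> bf bg fgC.
have -> : mean f - mean g = mean (fun x => f x + -1 * g x).
  by rewrite meanD ?meanZ ?mulN1r//; exact: bounded_measurableZ.
apply: norm_mean_le => [|x]; last by rewrite mulN1r.
by apply: bounded_measurableD => //; exact: bounded_measurableZ.
Qed.

Lemma bounded_measurable_indic (A : set R) : measurable A ->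
  bounded_measurable (\1_A : R -> R).
Proof.
move=> mA; split; first exact: measurable_indic.
by exists 1 => x; rewrite indicE; case: (_ \in _); rewrite ?normr1 ?normr0.
Qed.

Lemma mean_indic_itv_le x y : x <= y -> mean (\1_`[x, y]) <= y - x.
Proof.
move=> xy; rewrite /mean /Rintegral integral_indic//.
have h : (mu (`[x, y]%classic `&` `[0%R, 1%R[%classic) <= (y - x)%:E)%E.
  apply: (@le_trans _ _ (mu `[x, y]%classic)).
    by apply: le_measure; rewrite ?inE//; exact: measurableI.
  by rewrite lebesgue_measure_itv/=; case: ifP => _ //; rewrite ?lee_fin ?subr_ge0.
by rewrite -lee_fin fineK// ge0_fin_numE//; exact: le_lt_trans h (ltry _).
Qed.

End Mean.

(** * Energy of Fourier coefficients *)

Section Energy.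
Variable R : realType.
Implicit Types (f : R -> R) (w : R).

(** [cos_coef f w + i sin_coef f w] is the Fourier transform at [w] of the occupation measure of
    [f], and [energy f w] its squared modulus. *)
Definition cos_coef f w : R := mean (fun x => cos (w * f x)).
Definition sin_coef f w : R := mean (fun x => sin (w * f x)).
Definition energy f w : R := cos_coef f w ^+ 2 + sin_coef f w ^+ 2.

Let mZ w f : measurable_fun setT f -> measurable_fun setT (fun x => w * f x).
Proof. by move=> mf; exact: measurable_funM. Qed.

Lemma mean_cosB f w a : measurable_fun setT f ->
  mean (fun y => cos (w * (a - f y))) =
  cos (w * a) * cos_coef f w + sin (w * a) * sin_coef f w.
Proof.
move=> mf; have h := mZ w mf.
have bc := bounded_measurable_cos h; have bs := bounded_measurable_sin h.
rewrite -!meanZ// -meanD; try exact: bounded_measurableZ.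
by under eq_fun do rewrite mulrBr cosB.
Qed.

Lemma mean_sinB f w a : measurable_fun setT f ->
  mean (fun y => sin (w * (f y - a))) =
  cos (w * a) * sin_coef f w - sin (w * a) * cos_coef f w.
Proof.
move=> mf; have h := mZ w mf.
have bc := bounded_measurable_cos h; have bs := bounded_measurable_sin h.
rewrite -mulNr -!meanZ// -meanD; try exact: bounded_measurableZ.
by congr mean; apply/funext => y; rewrite mulrBr sinB; ring.
Qed.

Let bounded_measurable_comb f w c s : measurable_fun setT f ->
  bounded_measurable (fun x => cos (w * f x) * c + sin (w * f x) * s).
Proof.
move=> mf; have h := mZ w mf.
apply: bounded_measurableD; apply: bounded_measurableM; try exact: bounded_measurable_cst.
  exact: bounded_measurable_cos.
exact: bounded_measurable_sin.
Qed.

Lemma energyE f w : measurable_fun setT f ->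
  energy f w = mean (fun x => cos (w * f x) * cos_coef f w + sin (w * f x) * sin_coef f w).
Proof.
move=> mf; have h := mZ w mf.
have bc := bounded_measurable_cos h; have bs := bounded_measurable_sin h.
under eq_fun do rewrite mulrC [sin _ * _]mulrC.
by rewrite meanD ?meanZ//; exact: bounded_measurableZ.
Qed.

(** The double integral behind the energy is kept as an iterated mean, so a bound of the inner mean
    for each fixed [x] suffices and only linearity is used, no exchange of integrals. *)
Lemma sum_energy_le (J : finType) (F : J -> R -> R) w B :
  (forall j, measurable_fun setT (F j)) ->
  (forall x, 0 <= x < 1 -> mean (fun y => \sum_j cos (w * (F j x - F j y))) <= B) ->
  \sum_j energy (F j) w <= B.
Proof.
move=> mF FB; under eq_bigr do rewrite energyE//.
rewrite -mean_sum; last by move=> j; exact: bounded_measurable_comb.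
apply: mean_le => [|x x01].
  by apply: bounded_measurable_sum => j; exact: bounded_measurable_comb.
apply: le_trans (FB x x01); rewrite mean_sum.
  by under [leRHS]eq_bigr do rewrite mean_cosB//.
move=> j; apply: bounded_measurable_cos; apply: mZ.
by apply: measurable_funB.
Qed.

Lemma energy_ge0 f w : 0 <= energy f w.
Proof. by rewrite addr_ge0 ?sqr_ge0. Qed.

Lemma cos_coef_le1 f w : measurable_fun setT f -> `|cos_coef f w| <= 1.
Proof.
move=> mf; apply: norm_mean_le => [|x]; last exact: cos_max.
by apply: bounded_measurable_cos; exact: mZ.
Qed.

Lemma sin_coef_le1 f w : measurable_fun setT f -> `|sin_coef f w| <= 1.
Proof.
move=> mf; apply: norm_mean_le => [|x]; last exact: sin_max.
by apply: bounded_measurable_sin; exact: mZ.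
Qed.

Lemma cos_lipschitz (x y : R) : `|cos x - cos y| <= `|x - y|.
Proof.
wlog xy : x y / x <= y => [hw|].
  have [/hw//|/ltW /hw] := leP x y; by rewrite distrC [X in _ <= X -> _]distrC.
have [|z _] := @MVT_segment R cos (fun x => - sin x) x y xy (fun y _ => is_derive_cos y).
  exact/continuous_subspaceT/continuous_cos.
rewrite distrC => ->; rewrite normrM normrN [leRHS]distrC.
by rewrite ler_piMl ?normr_ge0 ?sin_max.
Qed.

Lemma sin_lipschitz (x y : R) : `|sin x - sin y| <= `|x - y|.
Proof.
wlog xy : x y / x <= y => [hw|].
  have [/hw//|/ltW /hw] := leP x y; by rewrite distrC [X in _ <= X -> _]distrC.
have [|z _] := @MVT_segment R sin cos x y xy (fun y _ => is_derive_sin y).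
  exact/continuous_subspaceT/continuous_sin.
rewrite distrC => ->; rewrite normrM [leRHS]distrC.
by rewrite ler_piMl ?normr_ge0 ?cos_max.
Qed.

(** Both coefficients are [w]-Lipschitz in [f] and bounded by 1, so each of the two squares moves by
    at most [2 w e]. *)
Lemma energy_lipschitz f f' w e : 0 <= w -> measurable_fun setT f ->
  measurable_fun setT f' -> (forall x, `|f x - f' x| <= e) ->
  `|energy f w - energy f' w| <= 4 * (w * e).
Proof.
move=> w0 mf mf' ff'; have h := mZ w mf; have h' := mZ w mf'.
have we x : `|w * f x - w * f' x| <= w * e.
  by rewrite -mulrBr normrM ger0_norm// ler_wpM2l.
have hc : `|cos_coef f w - cos_coef f' w| <= w * e.
  apply: norm_meanB_le => [||x]; try exact: bounded_measurable_cos.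
  exact: le_trans (cos_lipschitz _ _) (we x).
have hs : `|sin_coef f w - sin_coef f' w| <= w * e.
  apply: norm_meanB_le => [||x]; try exact: bounded_measurable_sin.
  exact: le_trans (sin_lipschitz _ _) (we x).
have sq (a a' : R) : `|a| <= 1 -> `|a'| <= 1 -> `|a - a'| <= w * e ->
    `|a ^+ 2 - a' ^+ 2| <= 2 * (w * e).
  move=> a1 a1' aa'; rewrite subr_sqr normrM mulrC ler_pM//.
  by rewrite (le_trans (ler_normD _ _))// -[2]/(1 + 1) lerD.
rewrite /energy opprD addrACA (le_trans (ler_normD _ _))//.
have -> : 4 * (w * e) = 2 * (w * e) + 2 * (w * e) by ring.
by rewrite lerD// sq// ?cos_coef_le1 ?sin_coef_le1.
Qed.

End Energy.

(** * Mean energy over a grid of parameters *)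

Section GridEnergy.
Variables (R : realType) (d : nat) (alpha c1 K : R).
Variables (W : R -> R) (Phi : R -> 'I_d -> R).
Hypothesis alpha_gt0 : 0 < alpha.
Hypothesis c1_gt0 : 0 < c1.
Hypothesis mW : measurable_fun setT W.
Hypothesis mPhi : forall i, measurable_fun setT (fun x => Phi x i).
Hypothesis PhiK : forall x i, `|Phi x i| <= K.
Hypothesis Phi_lower : forall x y,
  c1 * circ_dist x y `^ alpha <= sup_norm (fun i => Phi x i - Phi y i).

Definition combination (t : 'I_d -> R) (x : R) := W x + \sum_(i < d) t i * Phi x i.

Lemma measurable_combination t : measurable_fun setT (combination t).
Proof.
apply: measurable_funD => //; apply: measurable_sum => i.
exact: measurable_funM.
Qed.

Lemma combinationB t t' x e : (forall i, `|t i - t' i| <= e) ->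
  `|combination t x - combination t' x| <= d%:R * K * e.
Proof.
move=> tt'; rewrite /combination opprD addrACA subrr add0r -sumrB.
rewrite (le_trans (ler_norm_sum _ _ _))//.
apply: (@le_trans _ _ (\sum_(i < d) K * e)).
  apply: ler_sum => i _; rewrite -mulrBl normrM mulrC.
  by rewrite ler_pM.
by rewrite sumr_const card_ord -mulrA mulr_natl.
Qed.

Lemma sup_norm_attained (v : 'I_d -> R) c : 0 < c -> c <= sup_norm v ->
  exists i, c <= `|v i|.
Proof.
move=> c0 cv; apply: contrapT => /forallNP h; move: cv; apply/negP.
by rewrite -ltNge; apply: bigmax_lt => // i _; rewrite ltNge; exact/negP.
Qed.

(** Since [x - y] lies in [(-1, 1)], its floor is [0] or [-1]. A circular neighbourhood thus lies in
    three intervals of length [2 s], which is the origin of the constant 6 below. *)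
Lemma circ_dist_le_cases (x y s : R) : 0 <= x < 1 -> 0 <= y < 1 ->
  circ_dist x y <= s -> [|| `|x - y| <= s, `|x - y - 1| <= s | `|x - y + 1| <= s].
Proof.
move=> /andP[x0 x1] /andP[y0 y1]; rewrite /circ_dist /fracpart.
set u := x - y; have := floor_itv u; set n := Num.floor u => /andP[nu un].
have n1 : (-1 <= n)%R.
  by rewrite -ltzD1 -(ltr_int R); move: un; rewrite /u; lra.
have n0 : n <= 0 by rewrite -ltzD1 -(ltr_int R); move: nu; rewrite /u; lra.
rewrite ge_min => h.
have {n0 n1} [E|E] : n = 0 \/ n = -1.
  by move: n0 n1; clear; lia.
  move: h nu un; rewrite E => /orP[] h nu un; apply/or3P.
    by constructor 1; rewrite ler_norml; lra.
  by constructor 2; rewrite ler_norml; lra.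
move: h nu un; rewrite E => /orP[] h nu un; apply/or3P.
  by constructor 3; rewrite ler_norml; lra.
by constructor 1; rewrite ler_norml; lra.
Qed.

Definition grid_point (z : 'I_d -> R) (M r : nat) (f : {ffun 'I_d -> steps r M}) : 'I_d -> R :=
  fun i => z i + (step_sum (f i))%:R / M%:R.

(** For [y] within circular distance [s] of [x] the cosine is bounded by 1; for the others some
    coordinate of [Phi x - Phi y] is at least [c1 s^alpha] and the grid sum cancels. As that
    coordinate is at most [2 K], the condition [w * K <= M] excludes aliasing. *)
Lemma sum_energy_grid_le z (M r : nat) (w s : R) : (0 < M)%N -> 0 < w -> 0 < s ->
  w * K <= M%:R ->
  \sum_(f : {ffun 'I_d -> steps r M}) energy (combination (grid_point z f)) w <=
  (#|{: steps r M}| ^ d)%:R * (6 * s + (4 / (w * (c1 * s `^ alpha))) ^+ r).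
Proof.
move=> M0 w0 s0 wKM; apply: sum_energy_le => [f|x x01].
  exact: measurable_combination.
set Q := (_ ^ d)%:R; set B := (4 / _) ^+ r.
have Q0 : 0 <= Q by [].
have sa0 : 0 < s `^ alpha by rewrite powR_gt0.
have B0 : 0 <= B by rewrite exprn_ge0// divr_ge0// mulr_ge0// ?ltW// mulr_gt0.
(* A majorant of the sum as a function of [y]: the trivial bound on the three near intervals, plus
   the far bound everywhere. *)
pose h y : R := Q * (\1_`[x - s, x + s] y + (\1_`[x - 1 - s, x - 1 + s] y + \1_`[x + 1 - s, x + 1 + s] y)) + Q * B.
have bi (a b : R) : bounded_measurable (\1_`[a, b] : R -> R).
  exact: bounded_measurable_indic.
have bi2 : bounded_measurable (fun y : R => \1_`[x - 1 - s, x - 1 + s] y + \1_`[x + 1 - s, x + 1 + s] y : R).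
  exact: bounded_measurableD.
have bi3 : bounded_measurable (fun y : R => \1_`[x - s, x + s] y + (\1_`[x - 1 - s, x - 1 + s] y + \1_`[x + 1 - s, x + 1 + s] y) : R).
  exact: bounded_measurableD.
have bh : bounded_measurable h.
  apply: bounded_measurableD; last exact: bounded_measurable_cst.
  exact: bounded_measurableZ.
have hm : mean h <= Q * (6 * s + B).
  rewrite /h meanD; [|exact: bounded_measurableZ|exact: bounded_measurable_cst].
  rewrite (mean_cst (Q * B)) meanZ// mulrDr lerD2r ler_wpM2l//.
  rewrite meanD// meanD//.
  have i1 := @mean_indic_itv_le R (x - s) (x + s).
  have i2 := @mean_indic_itv_le R (x - 1 - s) (x - 1 + s).
  have i3 := @mean_indic_itv_le R (x + 1 - s) (x + 1 + s).
  have ss a : a - s <= a + s by rewrite lerD2l -subr_ge0 opprK addr_ge0// ltW.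
  move: (i1 (ss _)) (i2 (ss _)) (i3 (ss _)).
  lra.
apply: le_trans hm; apply: le_mean => //.
  apply: bounded_measurable_sum => f; apply: bounded_measurable_cos.
  apply: measurable_funM => //; apply: measurable_funB => //.
  exact: measurable_combination.
move=> y y01; rewrite /h.
have i0 (a b : R) : 0 <= \1_`[a, b] y :> R by rewrite indicE ler0n.
have [cs|cs] := leP (circ_dist x y) s.
  apply: (@le_trans _ _ Q).
    have -> : Q = \sum_(f : {ffun 'I_d -> steps r M}) 1.
      by rewrite sumr_const card_ffun card_ord.
    by apply: ler_sum => f _; exact: cos_le1.
  rewrite -[leLHS]addr0 lerD ?mulr_ge0// -[leLHS]mulr1 ler_wpM2l//.
  have := @circ_dist_le_cases x y s x01 y01 cs.
  have i1 (a b : R) : a <= y <= b -> \1_`[a, b] y = 1 :> R.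
    by move=> ab; rewrite indicE mem_set//= in_itv.
  case/or3P; rewrite ler_norml => hs.
  - by rewrite i1 ?lerDl ?addr_ge0//; lra.
  - by rewrite (i1 (x - 1 - s)) ?addrA; [rewrite addrAC lerDr addr_ge0|lra].
  - by rewrite (i1 (x + 1 - s)) ?addrA; [rewrite lerDr addr_ge0|lra].
have [i1 hi1] : exists i, c1 * s `^ alpha <= `|Phi x i - Phi y i|.
  apply: sup_norm_attained; first by rewrite mulr_gt0.
  apply: le_trans (Phi_lower x y); rewrite ler_wpM2l// ?(ltW c1_gt0)//.
  by rewrite ge0_ler_powR// ?nnegrE ?ltW// (lt_trans s0).
pose v i := w * (Phi x i - Phi y i).
pose a := w * (W x - W y + \sum_(i < d) z i * (Phi x i - Phi y i)).
have vi1 : w * (c1 * s `^ alpha) <= `|v i1|.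
  by rewrite /v normrM (ger0_norm (ltW w0)) ler_wpM2l// ltW.
have vp : 0 < w * (c1 * s `^ alpha) by rewrite !mulr_gt0.
have vp1 : 0 < `|v i1| by apply: lt_le_trans vi1.
rewrite -[leLHS]add0r lerD//.
  by rewrite mulr_ge0// !addr_ge0.
under eq_bigr => f _.
  rewrite (_ : w * _ = a + \sum_i (step_sum (f i))%:R / M%:R * v i).
    over.
  rewrite /a /v /combination /grid_point.
  under [in X in _ = _ + X]eq_bigr do rewrite mulrCA.
  rewrite -mulr_sumr -mulrDr; congr (w * _).
  rewrite opprD addrACA -sumrB -[RHS]addrA -big_split/=; congr (_ + _).
  by apply: eq_bigr => i _; ring.
apply: le_trans (grid_sum_cos_le _ _ _ _ _) _.
- exact: M0.
- by rewrite -normr_gt0; exact: vp1.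
- rewrite /v normrM (ger0_norm (ltW w0)).
  apply: (@le_trans _ _ (w * (2 * K))); last by rewrite mulrCA ler_wpM2l.
  rewrite ler_wpM2l// ?(ltW w0)// (le_trans (ler_normB _ _))//.
  by have := PhiK x i1; have := PhiK y i1; lra.
- rewrite ler_wpM2l// lerXn2r ?nnegrE ?divr_ge0 ?(ltW vp)//.
  by rewrite ler_wpM2l// lef_pV2.
Qed.

End GridEnergy.

(** * Markov's inequality on grid cells *)

Lemma sum_injective_le (R : realType) (I J : finType) (h : I -> J) (G : J -> R) :
  injective h -> (forall j, 0 <= G j) -> \sum_i G (h i) <= \sum_j G j.
Proof.
move=> hi G0; rewrite -(big_imset G (in2W hi))/=.
by rewrite big_mkcond; apply: ler_sum => j _; case: ifP.
Qed.

Section GridMarkov.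
Variables (R : realType) (d r M : nat) (z : 'I_d -> R).
Variables (g : ('I_d -> R) -> R) (E eta : R).
Hypotheses (d_gt0 : (0 < d)%N) (M_gt0 : (0 < M)%N) (eta_gt0 : 0 < eta).
Hypothesis g_ge0 : forall t, 0 <= g t.
Hypothesis g_avg : \sum_(f : {ffun 'I_d -> steps r M}) g (grid_point z f) <=
  (#|{: steps r M}| ^ d)%:R * E.
Hypothesis g_osc : forall t t', (forall i, `|t i - t' i| <= M%:R^-1) ->
  `|g t - g t'| <= eta / 2.

(** The lower corners of the cells of side [1/M] in the cube [z + [r, r+1)^d]. The offset [r * M]
    exceeds no less than any sum of [r] short steps, so a long step can always complete it. *)
Definition cell_corner (l : {ffun 'I_d -> 'I_M}) : 'I_d -> R :=
  fun i => z i + (r * M + l i)%:R / M%:R.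

Let shift_lt (l : 'I_M) (h : {ffun 'I_r -> 'I_M}) :
  (r * M + l - \sum_j h j < r.+1 * M)%N.
Proof.
by rewrite (leq_ltn_trans (leq_subr _ _))// mulSn addnC ltn_add2r.
Qed.

(** The long step is solved for: a cell and arbitrary short steps determine it, which injects these
    pairs into the grid choices. *)
Let shifted (p : {ffun 'I_d -> 'I_M} * {ffun 'I_d -> {ffun 'I_r -> 'I_M}}) :
    {ffun 'I_d -> steps r M} :=
  [ffun i => (Ordinal (shift_lt (p.1 i) (p.2 i)), p.2 i)].

Let sum_le (h : {ffun 'I_r -> 'I_M}) : (\sum_j h j <= r * M)%N.
Proof.
rewrite -[X in (_ <= X * _)%N](card_ord r) -sum_nat_const.
by apply: leq_sum => j _; exact: ltnW.
Qed.

Let step_sum_shifted p i : step_sum (shifted p i) = (r * M + p.1 i)%N.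
Proof.
by rewrite /step_sum ffunE/= subnK// (leq_trans (sum_le _))// leq_addr.
Qed.

Let shifted_inj : injective shifted.
Proof.
move=> p q pq.
have e2 : p.2 = q.2.
  by apply/ffunP => i; have := congr1 (fun f : {ffun 'I_d -> steps r M} => (f i).2) pq; rewrite !ffunE.
have e1 : p.1 = q.1.
  apply/ffunP => i; apply: val_inj; apply: (@addnI (r * M)).
  by rewrite /= -!step_sum_shifted pq.
by move: p q e1 e2 {pq} => [? ?] [? ?] /= -> ->.
Qed.

Let sum_cells_le : ((M ^ r) ^ d)%:R * \sum_l g (cell_corner l) <=
  (#|{: steps r M}| ^ d)%:R * E.
Proof.
apply: le_trans g_avg; apply: le_trans (sum_injective_le shifted_inj _) => //.
rewrite (eq_bigr (fun p => g (cell_corner p.1))); last first.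
  by move=> p _; congr g; apply/funext => i; rewrite /grid_point step_sum_shifted.
rewrite -(pair_bigA _ (fun l _ => g (cell_corner l)))/= le_eqVlt; apply/orP; left.
apply/eqP; rewrite mulr_sumr; apply: eq_bigr => l _.
by rewrite sumr_const !card_ffun !card_ord mulr_natl.
Qed.

(* Markov's inequality. Each cell of the cube is reached from every choice of the
   short steps, so the plain sum over cells is at most the grid sum divided by
   the number of these choices. *)
Lemma covered_large_values :
  covered [set t | (forall i, z i + r%:R <= t i < z i + r.+1%:R) /\ eta < g t]
    (r.+1%:R ^+ d * (2 * E / eta)).
Proof.
have Mp : 0 < M%:R :> R by rewrite ltr0n.
(* Over a cell [g] oscillates by at most [eta / 2], so a cell that meets [eta < g] has a corner in
   [P]. *)
pose P : pred {ffun 'I_d -> 'I_M} := fun l => eta / 2 <= g (cell_corner l).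
have cP : #|P|%:R * (M%:R^-1 ^+ d) <= r.+1%:R ^+ d * (2 * E / eta).
  have h1 : #|P|%:R * (eta / 2) <= \sum_l g (cell_corner l).
    rewrite mulr_natl -sumr_const big_mkcond/=; apply: ler_sum => l _.
    by case: ifP => // Pl; exact: Pl.
  have Mr : 0 < ((M ^ r) ^ d)%:R :> R by rewrite ltr0n !expn_gt0 M_gt0.
  have := le_trans (ler_wpM2l (ltW Mr) h1) sum_cells_le.
  rewrite card_steps !expnMn !natrM !natrX => h2.
  rewrite exprVn ler_pdivrMr ?exprn_gt0//.
  have Mr' : 0 < (M%:R ^+ r) ^+ d :> R by rewrite !exprn_gt0.
  have -> : r.+1%:R ^+ d * (2 * E / eta) * M%:R ^+ d =
      r.+1%:R ^+ d * M%:R ^+ d * E / (eta / 2) by field; rewrite gt_eqF.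
  rewrite ler_pdivlMr ?divr_gt0// -(ler_pM2l Mr').
  by apply: le_trans h2 _; rewrite le_eqVlt; apply/orP; left; apply/eqP; ring.
apply: coveredW (@subset_refl _ _) cP _.
apply: (@covered_finite _ _ _ _ _ P cell_corner (fun l i => cell_corner l i + M%:R^-1)).
- exact: d_gt0.
- by rewrite exprn_ge0// invr_ge0.
- by move=> l i; rewrite lerDl invr_ge0.
- move=> l; rewrite /box_vol (eq_bigr (fun=> M%:R^-1)); last first.
    by move=> i _; rewrite addrC addKr.
  by rewrite prodr_const card_ord.
move=> t /= [tz gt].
pose u i := (t i - z i - r%:R) * M%:R.
have u0 i : 0 <= u i by rewrite mulr_ge0 ?(ltW Mp)//; have := tz i; lra.
have uM i : (Num.truncn (u i) < M)%N.
  rewrite truncn_lt_nat// /u -[ltRHS]mul1r ltr_pM2r//.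
  by have := tz i; rewrite -natr1; lra.
pose l : {ffun 'I_d -> 'I_M} := [ffun i => Ordinal (uM i)].
have tl i : cell_corner l i <= t i <= cell_corner l i + M%:R^-1.
  have := truncn_itv (u0 i); rewrite -natr1.
  have -> : cell_corner l i = z i + r%:R + (Num.truncn (u i))%:R / M%:R.
    by rewrite /cell_corner ffunE/= natrD natrM; field; rewrite gt_eqF.
  move: (Num.truncn (u i))%:R => q /andP[q1 q2].
  have e : t i = z i + r%:R + u i / M%:R by rewrite /u mulfK ?gt_eqF//; ring.
  have q1' : q / M%:R <= u i / M%:R by rewrite ler_pM2r ?invr_gt0.
  have q2' : u i / M%:R <= q / M%:R + M%:R^-1.
    by rewrite -[X in _ + X]div1r -mulrDl ler_pM2r ?invr_gt0// ltW.
  rewrite e; lra.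
exists l => //; rewrite /P.
have := @g_osc t (cell_corner l).
have h i : `|t i - cell_corner l i| <= M%:R^-1.
  by have := tl i; rewrite ler_norml; have : 0 <= M%:R^-1 :> R by []; lra.
by move=> /(_ h); rewrite ler_norml => /andP[_]; move: gt; lra.
Qed.

End GridMarkov.

(** * Dyadic blocks and the choice of the exponent *)

Section Blocks.
Variable R : realType.

Lemma sum_dyadic_blocks (a : nat -> R) m :
  \sum_(1 <= k < 2 ^ m) a k = \sum_(0 <= n < m) \sum_(2 ^ n <= k < 2 ^ n.+1) a k.
Proof.
elim: m => [|m IH]; first by rewrite !big_geq.
rewrite big_nat_recr//= -IH [LHS](@big_cat_nat _ _ _ (2 ^ m))//=.
  by rewrite expn_gt0.
by rewrite leq_exp2l.
Qed.

Lemma dyadic_blocks_summable (a : nat -> R) (x C : R) n0 : (forall k, 0 <= a k) ->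
  0 <= x < 1 -> 0 <= C ->
  (forall n, (n0 <= n)%N -> \sum_(2 ^ n <= k < 2 ^ n.+1) a k <= C * x ^+ n) ->
  exists B, forall n, \sum_(1 <= k < n) a k <= B.
Proof.
move=> a0 x01 C0 hb; have /andP[x0 x1] := x01.
exists (\sum_(0 <= n < n0) \sum_(2 ^ n <= k < 2 ^ n.+1) a k + C * (1 - x)^-1) => m.
have b0 n : 0 <= \sum_(2 ^ n <= k < 2 ^ n.+1) a k by apply: sumr_ge0.
apply: (@le_trans _ _ (\sum_(1 <= k < 2 ^ (n0 + m)) a k)).
  have [m1|m1] := ltnP m 1; first by rewrite big_geq ?sumr_ge0// ltnW.
  rewrite [leRHS](@big_cat_nat _ _ _ m)//= ?lerDl ?sumr_ge0//.
  by rewrite (leq_trans (ltnW (ltn_expl m (ltnSn 1))))// leq_exp2l// leq_addl.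
rewrite sum_dyadic_blocks (@big_cat_nat _ _ _ n0)//= ?leq_addr// lerD2l.
apply: (@le_trans _ _ (\sum_(n0 <= n < n0 + m) C * x ^+ n)).
  by rewrite big_nat [leRHS]big_nat; apply: ler_sum => n /andP[h _]; exact: hb.
rewrite -mulr_sumr ler_wpM2l//.
apply: (@le_trans _ _ (\sum_(0 <= n < n0 + m) x ^+ n)); last exact: geometric_sum_le.
rewrite [leRHS](@big_cat_nat _ _ _ n0)//= ?leq_addr// lerDr.
by apply: sumr_ge0 => n _; exact: exprn_ge0.
Qed.

(* [x ^+ 3 / 4] plays the role of [2^(-q)] with [2 < q < 1 / alpha]; writing it
   in terms of [x < 1] makes all later bounds integer powers. *)
Lemma exponent_choice (alpha : R) : 0 < alpha -> alpha < 2^-1 ->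
  exists2 x : R, 0 < x < 1 &
    exists r : nat, (2 * (x ^+ 3 / 4) `^ alpha)^-1 ^+ r <= x ^+ 3 / 4.
Proof.
move=> a0 a1.
pose s : R := 2 * 4^-1 `^ alpha.
have s1 : 1 < s.
  rewrite /s -ltr_pdivrMl// mulr1.
  have -> : 2^-1 = 4^-1 `^ 2^-1 :> R.
    have -> : 4^-1 = 2^-1 `^ 2 :> R by rewrite powR_mulrn//; field.
    by rewrite -powRrM divff// powRr1.
  rewrite /powR gt_eqF ?invr_gt0// ltr_expR ltr_nM2r//.
  by rewrite ln_lt0// invr_gt0 ltr0n invf_lt1 ?ltr1n.
(* With [x = 1 - (1 - y) / 4], Bernoulli's inequality gives [x^3 >= 1 - 3 (1 - y) / 4 > y], that is
   [x^3 s > 1]. *)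
pose y := s^-1; pose x : R := (3 + y) / 4.
have y0 : 0 < y by rewrite invr_gt0; lra.
have y1 : y < 1 by rewrite invf_lt1//; lra.
have x01 : 0 < x < 1 by rewrite /x; lra.
have x3 : y < x ^+ 3.
  rewrite -subr_gt0 (_ : _ - _ = (1 - y) * (27 - 10 * y - y ^+ 2) / 64); last first.
    by rewrite /x; field.
  by rewrite divr_gt0// mulr_gt0; nra.
have x3p : 0 < x ^+ 3 by lra.
have x31 : x ^+ 3 <= 1 by rewrite exprn_ile1//; lra.
exists x => //.
have k1 : 1 < 2 * (x ^+ 3 / 4) `^ alpha.
  rewrite powRM ?invr_ge0 ?(ltW x3p)// mulrCA -/s.
  have : x ^+ 3 <= (x ^+ 3) `^ alpha.
    by apply: ger1_powR; rewrite ?x3p ?x31//; lra.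
  move=> h; apply: (@lt_le_trans _ _ (x ^+ 3 * s)); last first.
    by rewrite ler_wpM2r//; lra.
  by rewrite -ltr_pdivrMr ?div1r//; lra.
set k := 2 * _ in k1 *.
have : k^-1 ^+ n @[n --> \oo] --> (0 : R).
  by apply: cvg_expr; rewrite ger0_norm ?invr_ge0 ?invf_lt1//; lra.
have q0 : 0 < x ^+ 3 / 4 by lra.
move=> /cvgrPdist_le /(_ _ q0)[n0 _ /(_ n0 (leqnn _))].
by rewrite sub0r normrN => h; exists n0; rewrite (le_trans (ler_norm _)).
Qed.

End Blocks.

(** * The exceptional null set *)

Section NullSet.
Variables (R : realType) (d : nat) (alpha c1 K : R).
Variables (W : R -> R) (Phi : R -> 'I_d -> R).
Hypothesis d_gt0 : (0 < d)%N.
Hypothesis alpha_gt0 : 0 < alpha.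
Hypothesis c1_gt0 : 0 < c1.
Hypothesis mW : measurable_fun setT W.
Hypothesis mPhi : forall i, measurable_fun setT (fun x => Phi x i).
Hypothesis PhiK : forall x i, `|Phi x i| <= K.
Hypothesis Phi_lower : forall x y,
  c1 * circ_dist x y `^ alpha <= sup_norm (fun i => Phi x i - Phi y i).

Definition block_energy (L n : nat) (t : 'I_d -> R) : R :=
  \sum_(2 ^ n <= k < 2 ^ n.+1) energy (combination W Phi t) (k%:R / L%:R).

Let K_ge0 : 0 <= K.
Proof. exact: le_trans (normr_ge0 _) (PhiK 0 (Ordinal d_gt0)). Qed.

Let sum_block_cst n (c : R) : \sum_(2 ^ n <= k < 2 ^ n.+1) c = 2 ^+ n * c.
Proof. by rewrite sumr_const_nat expnS mul2n -addnn addnK -[LHS]mulr_natl natrX. Qed.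

(** The constant may grow with [n]: it enters only the choice of the mesh. *)
Lemma block_energy_lipschitz L n : exists2 C, 0 <= C &
  forall t t' e, (forall i, `|t i - t' i| <= e) ->
  `|block_energy L n t - block_energy L n t'| <= C * e.
Proof.
exists (\sum_(2 ^ n <= k < 2 ^ n.+1) 4 * (k%:R / L%:R * (d%:R * K))) => [|t t' e tt'].
  by apply: sumr_ge0 => k _; rewrite !mulr_ge0.
rewrite /block_energy -sumrB (le_trans (ler_norm_sum _ _ _))// mulr_suml.
apply: ler_sum => k _; rewrite -!mulrA.
have := @energy_lipschitz R (combination W Phi t) (combination W Phi t') (k%:R / L%:R) (d%:R * K * e).
rewrite -!mulrA; apply.
- by rewrite divr_ge0.
- exact: measurable_combination.
- exact: measurable_combination.
- by move=> x; have := combinationB W PhiK x tt'; rewrite -mulrA.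
Qed.

Section FixedParameters.
Variables (L r : nat) (x : R) (z : 'I_d -> R).
Hypothesis L_gt0 : (0 < L)%N.
Hypothesis x01 : 0 < x < 1.
Hypothesis xr : (2 * (x ^+ 3 / 4) `^ alpha)^-1 ^+ r <= x ^+ 3 / 4.

Let C : R := 6 + (4 * L%:R / c1) ^+ r.

(** The splitting distance is [s = y^n] with [y = x^3 / 4]. The near part gives the 6 in [C]. In the
    far part [k >= 2^n] yields [(4 L / c1)^r] times [kappa^(-n r)] with [kappa = 2 y^alpha], and the
    choice of [r] turns the latter into at most [s]. Summing over [2^n] frequencies replaces [y] by
    [2 y]. *)
Let sum_block_energy n M : (0 < M)%N -> 2 ^+ n.+1 * K <= M%:R ->
  \sum_(f : {ffun 'I_d -> steps r M}) block_energy L n (grid_point z f) <=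
  (#|{: steps r M}| ^ d)%:R * (C * (x ^+ 3 / 2) ^+ n).
Proof.
move=> M0 MK; rewrite /block_energy exchange_big/=.
have Lp : 0 < L%:R :> R by rewrite ltr0n.
have /andP[x0 x1] := x01.
pose y := x ^+ 3 / 4; have y0 : 0 < y by rewrite divr_gt0// exprn_gt0.
pose s := y ^+ n; have s0 : 0 < s by rewrite exprn_gt0.
pose kappa := 2 * y `^ alpha.
have ya : 0 < y `^ alpha by rewrite powR_gt0.
have k0 : 0 < kappa by rewrite mulr_gt0.
have -> : (#|{: steps r M}| ^ d)%:R * (C * (x ^+ 3 / 2) ^+ n) =
    \sum_(2 ^ n <= k < 2 ^ n.+1) (#|{: steps r M}| ^ d)%:R * (C * s) :> R.
  have -> : (x ^+ 3 / 2) ^+ n = 2 ^+ n * s.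
    by rewrite /s /y -exprMn; congr (_ ^+ _); field.
  by rewrite sum_block_cst; ring.
rewrite big_nat [leRHS]big_nat; apply: ler_sum => k /andP[kn kn1].
have kp : 0 < k%:R :> R by rewrite ltr0n (leq_trans _ kn)// expn_gt0.
have w0 : 0 < k%:R / L%:R :> R by rewrite divr_gt0.
have := @sum_energy_grid_le R d alpha c1 K W Phi alpha_gt0 c1_gt0 mW mPhi PhiK Phi_lower
  z M r _ _ M0 w0 s0.
have wK : k%:R / L%:R * K <= M%:R.
  apply: le_trans MK; rewrite ler_wpM2r// ler_pdivrMr// -natrX -natrM ler_nat.
  by rewrite (leq_trans (ltnW kn1))// leq_pmulr.
move=> /(_ wK) h; apply: (le_trans h); apply: ler_wpM2l => //.
have -> : C * s = 6 * s + (4 * L%:R / c1) ^+ r * s by rewrite /C mulrDl.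
rewrite lerD2l.
have E : s `^ alpha = (y `^ alpha) ^+ n.
  by rewrite /s -(powR_mulrn n (ltW y0)) powRAC powR_mulrn ?powR_ge0.
apply: (@le_trans _ _ ((4 * L%:R / c1 * (kappa^-1) ^+ n) ^+ r)).
  rewrite lerXn2r ?nnegrE//.
  - by rewrite divr_ge0// mulr_ge0 ?(ltW w0)// mulr_ge0 ?powR_ge0 ?ltW.
  - by rewrite mulr_ge0 ?divr_ge0 ?mulr_ge0 ?exprn_ge0 ?invr_ge0 ?ltW.
  - have dp : 0 < c1 / L%:R * kappa ^+ n by rewrite mulr_gt0 ?exprn_gt0 ?divr_gt0.
    have -> : 4 * L%:R / c1 * kappa^-1 ^+ n = 4 / (c1 / L%:R * kappa ^+ n).
      by rewrite exprVn; field; rewrite !gt_eqF// exprn_gt0.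
    have le1 : c1 / L%:R * kappa ^+ n <= k%:R / L%:R * (c1 * s `^ alpha).
      rewrite /kappa exprMn E.
      have -> : c1 / L%:R * (2 ^+ n * y `^ alpha ^+ n) =
        2 ^+ n / L%:R * (c1 * y `^ alpha ^+ n) by ring.
      rewrite ler_wpM2r ?mulr_ge0 ?exprn_ge0 ?powR_ge0 ?(ltW c1_gt0)//.
      by rewrite ler_wpM2r ?invr_ge0// -natrX ler_nat.
    by rewrite ler_wpM2l// lef_pV2 ?posrE// (lt_le_trans dp).
rewrite exprMn ler_wpM2l//.
  by rewrite exprn_ge0 ?divr_ge0 ?mulr_ge0 ?ltW.
rewrite -exprM mulnC exprM lerXn2r ?nnegrE ?exprn_ge0 ?invr_ge0 ?(ltW k0) ?(ltW y0)//.
Qed.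

(** Markov's inequality compares the mean [C (x^3 / 2)^n] with the threshold [(x^2 / 2)^n]. One
    factor [x] is spent here on the measure of the bad set; the other two become, after a square
    root, the decay of the coefficient sums. *)
Lemma covered_bad_block n :
  covered [set t | (forall i, z i + r%:R <= t i < z i + r.+1%:R) /\
                   (x ^+ 2 / 2) ^+ n < block_energy L n t]
    (r.+1%:R ^+ d * (2 * C) * x ^+ n).
Proof.
have /andP[x0 x1] := x01.
have [Lam Lam0 hLam] := block_energy_lipschitz L n.
pose eta := (x ^+ 2 / 2) ^+ n.
have eta0 : 0 < eta by rewrite exprn_gt0// divr_gt0// exprn_gt0.
(* The first summand resolves all frequencies [k < 2^(n+1)] of the block, the second makes the
   oscillation over a cell at most [eta / 2]. *)
pose Y := 2 ^+ n.+1 * K + 2 * Lam / eta.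
have Y0 : 0 <= Y by rewrite addr_ge0 ?mulr_ge0 ?exprn_ge0 ?invr_ge0 ?(ltW eta0).
pose M := (Num.truncn Y).+1.
have YM : Y <= M%:R by rewrite ltW// truncnS_gt.
have MK : 2 ^+ n.+1 * K <= M%:R.
  by apply: le_trans YM; rewrite lerDl ?mulr_ge0 ?invr_ge0 ?(ltW eta0).
have Mp : 0 < M%:R :> R by rewrite ltr0n.
have M0 : (0 < M)%N by [].
apply: coveredW (@subset_refl _ _) _ (covered_large_values d_gt0 M0 eta0 _ (sum_block_energy M0 MK) _).
- rewrite -!mulrA ler_wpM2l ?exprn_ge0// ler_wpM2l// ler_wpM2l//.
    by rewrite addr_ge0// exprn_ge0// divr_ge0// ?mulr_ge0// ltW.
  rewrite ler_pdivrMr// /eta -exprMn le_eqVlt; apply/orP; left; apply/eqP.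
  by congr (_ ^+ _); field.
- by move=> t; apply: sumr_ge0 => k _; exact: energy_ge0.
move=> t t' tt'; apply: le_trans (hLam _ _ _ tt') _.
rewrite ler_pdivrMr//.
have : 2 * Lam / eta <= M%:R.
  by apply: le_trans YM; rewrite lerDr mulr_ge0 ?exprn_ge0.
rewrite ler_pdivrMr//; lra.
Qed.

End FixedParameters.


Definition fourier_summable (f : R -> R) (L : nat) := exists B, forall n,
  \sum_(1 <= k < n) (`|cos_coef f (k%:R / L%:R)| + `|sin_coef f (k%:R / L%:R)|) <= B.

(* With [m = (2/x)^n], each term is at most [(m * energy + 2 / m) / 2]. *)
Lemma fourier_summable_of_blocks L t (x : R) n0 : 0 < x < 1 ->
  (forall n, (n0 <= n)%N -> block_energy L n t <= (x ^+ 2 / 2) ^+ n) ->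
  fourier_summable (combination W Phi t) L.
Proof.
move=> /andP[x0 x1] hb; apply: (@dyadic_blocks_summable R _ x 2 n0) => //.
  by rewrite (ltW x0).
move=> n /hb; rewrite /block_energy => h.
pose m : R := (2 / x) ^+ n.
have m0 : 0 < m by rewrite exprn_gt0// divr_gt0.
have amgm (c s : R) : `|c| + `|s| <= m / 2 * (c ^+ 2 + s ^+ 2) + m^-1.
  have one (u : R) : `|u| <= m / 2 * u ^+ 2 + m^-1 / 2.
    rewrite -subr_ge0 -[u ^+ 2]real_normK ?num_real//.
    have -> : m / 2 * `|u| ^+ 2 + m^-1 / 2 - `|u| = (m * `|u| - 1) ^+ 2 / (2 * m).
      by field; rewrite gt_eqF.
    by rewrite divr_ge0 ?sqr_ge0// mulr_ge0// ltW.
  by have := one c; have := one s; lra.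
apply: (@le_trans _ _ (\sum_(2 ^ n <= k < 2 ^ n.+1)
    (m / 2 * energy (combination W Phi t) (k%:R / L%:R) + m^-1))).
  by apply: ler_sum => k _; exact: amgm.
rewrite big_split/= sum_block_cst -mulr_sumr.
have -> : 2 * x ^+ n = m / 2 * (2 * (x ^+ 2 / 2) ^+ n) + 2 ^+ n * m^-1.
  have -> : 2 ^+ n * m^-1 = x ^+ n.
    by rewrite /m -exprVn -exprMn; congr (_ ^+ _); field; rewrite gt_eqF.
  have -> : m / 2 * (2 * (x ^+ 2 / 2) ^+ n) = x ^+ n; last by ring.
    have -> : m / 2 * (2 * (x ^+ 2 / 2) ^+ n) = m * (x ^+ 2 / 2) ^+ n by field.
    by rewrite /m -exprMn; congr (_ ^+ _); field; rewrite gt_eqF.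
rewrite lerD2r ler_wpM2l ?divr_ge0 ?(ltW m0)//.
by apply: (le_trans h); rewrite ler_peMl// ?exprn_ge0 ?divr_ge0 ?sqr_ge0// ler1n.
Qed.

(** The estimates are for one [L] and one unit cube; integer translates of the cube cover the space,
    so the bad set is a countable union over pairs of [L] and an integer vector. *)
Lemma null_not_fourier_summable : alpha < 2^-1 ->
  lebesgue_null [set t | exists2 L, (0 < L)%N & ~ fourier_summable (combination W Phi t) L].
Proof.
move=> alpha2.
have [x x01 [r xr]] := exponent_choice alpha_gt0 alpha2.
have /andP[x0 x1] := x01.
pose cube (z : 'I_d -> R) := [set t : 'I_d -> R | forall i, z i + r%:R <= t i < z i + r.+1%:R].
pose zR (z : {ffun 'I_d -> int}) : 'I_d -> R := fun i => (z i)%:~R.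
pose N n := if @unpickle (nat * {ffun 'I_d -> int})%type n is Some p then
  [set t | (0 < p.1)%N /\ ~ fourier_summable (combination W Phi t) p.1] `&` cube (zR p.2)
  else set0.
have sub : [set t | exists2 L, (0 < L)%N & ~ fourier_summable (combination W Phi t) L]
    `<=` \bigcup_n N n.
  move=> t [L L0 tL].
  (* The shift by [r] reflects that the grid based at [z] controls only the cube [z +
     [r, r+1)^d]. *)
  pose z : {ffun 'I_d -> int} := [ffun i => Num.floor (t i - r%:R)].
  exists (pickle (L, z)) => //; rewrite /N pickleK; split => // i.
  rewrite /zR ffunE -natr1; have := floor_itv (t i - r%:R); lra.
move=> eps eps0; apply: (coveredW sub (lexx _)).
apply: (null_bigcup d_gt0) eps0 => n; rewrite /N.
case: unpickle => [[L z]|]; last first.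
  by move=> e e0; exact: coveredW (@subset_refl _ _) (ltW e0) (covered0 _ d_gt0).
have [L0|L0] := posnP L.
  move=> e e0; apply: (@coveredW _ _ _ set0 _ 0) (ltW e0) (covered0 _ d_gt0).
  by move=> t [] []; rewrite /= L0.
pose C : R := r.+1%:R ^+ d * (2 * (6 + (4 * L%:R / c1) ^+ r)).
have C0 : 0 <= C.
  by rewrite mulr_ge0 ?exprn_ge0// mulr_ge0// addr_ge0// exprn_ge0// divr_ge0 ?mulr_ge0// ltW.
have x01' : 0 <= x < 1 by rewrite ltW.
apply: (null_limsup d_gt0 x01' C0 (fun n => covered_bad_block (zR z) L0 x01 xr n)).
move=> t /= [[_ tL] tz] n0; apply: contrapT => h; apply: tL.
apply: (fourier_summable_of_blocks x01 (n0 := n0)) => n' nn'; rewrite leNgt.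
by apply/negP => h'; apply: h; exists n'.
Qed.

End NullSet.

(** * Fejer kernel and Fourier inversion *)

Section FejerKernel.
Variable R : realType.
Implicit Types (u v x y : R).

Definition dirichlet (n : nat) u : R := 1 + \sum_(1 <= k < n.+1) 2 * cos (k%:R * u).

(* [fejer n] is the Fejer kernel of order [n + 1]. *)
Definition fejer (n : nat) u : R :=
  n.+1%:R^-1 * \sum_(0 <= j < n.+1) dirichlet j u.

(** The odd antiderivative of [fejer n]. On [[-pi, pi]] it tends to [pi] times the sign, which turns
    kernel averages into distribution functions. *)
Definition fejer_primitive (n : nat) v : R :=
  v + n.+1%:R^-1 * \sum_(0 <= j < n.+1) \sum_(1 <= k < j.+1) 2 * (k%:R^-1 * sin (k%:R * v)).

(** The closed forms of the kernels are stated with denominators cleared, so that they hold also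
    where [sin (u / 2)] vanishes. *)
Lemma sin_mul_dirichlet n u : sin (u / 2) * dirichlet n u = sin ((n%:R + 2^-1) * u).
Proof.
elim: n => [|n IH]; first by rewrite /dirichlet big_geq// addr0 mulr1 add0r mulrC.
rewrite /dirichlet big_nat_recr//= addrA mulrDr -/(dirichlet n u) IH.
have -> : (n%:R + 2^-1) * u = n.+1%:R * u - u / 2 by rewrite -natr1; field.
have -> : (n.+1%:R + 2^-1) * u = n.+1%:R * u + u / 2 by field.
by rewrite sinB sinD; ring.
Qed.

Lemma sqr_sin_mul_sum_dirichlet n u :
  sin (u / 2) ^+ 2 * \sum_(0 <= j < n) dirichlet j u = sin (n%:R * u / 2) ^+ 2.
Proof.
elim: n => [|n IH]; first by rewrite big_geq// !mulr0 !mul0r sin0 expr0n.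
rewrite big_nat_recr//= mulrDr IH expr2 -[X in _ + X]mulrA sin_mul_dirichlet.
set a := n%:R * u / 2; set b := u / 2.
have -> : (n%:R + 2^-1) * u = (a + b) + a by rewrite /a /b; field.
have -> : n.+1%:R * u / 2 = a + b by rewrite /a /b -natr1; field.
rewrite [sin (a + b + a)]sinD !sinD cosD.
have := cos2Dsin2 b.
set sa := sin a; set sb := sin b; set ca := cos a; set cb := cos b => hb.
have E : (sa * cb + ca * sb) ^+ 2 -
    (sa * sa + sb * ((sa * cb + ca * sb) * ca + (ca * cb - sa * sb) * sa)) =
    sa ^+ 2 * ((cb ^+ 2 + sb ^+ 2) - 1) by ring.
by apply/eqP; rewrite eq_sym -subr_eq0 E hb subrr mulr0.
Qed.

Lemma sqr_sin_mul_fejer n u :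
  sin (u / 2) ^+ 2 * fejer n u = n.+1%:R^-1 * sin (n.+1%:R * u / 2) ^+ 2.
Proof. by rewrite /fejer mulrCA sqr_sin_mul_sum_dirichlet. Qed.

Lemma fejer_ge0 n u : sin (u / 2) != 0 -> 0 <= fejer n u.
Proof.
move=> s0; have sp : 0 < sin (u / 2) ^+ 2 by rewrite exprn_even_gt0.
by rewrite -(pmulr_rge0 _ sp) sqr_sin_mul_fejer mulr_ge0 ?invr_ge0 ?sqr_ge0.
Qed.

Lemma fejer_le n u : sin (u / 2) != 0 -> fejer n u <= (n.+1%:R * sin (u / 2) ^+ 2)^-1.
Proof.
move=> s0; have sp : 0 < sin (u / 2) ^+ 2 by rewrite exprn_even_gt0.
rewrite invfM [_^-1 * _]mulrC -ler_pdivrMl ?invr_gt0// invrK sqr_sin_mul_fejer.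
by rewrite -[leRHS]mulr1 ler_wpM2l ?invr_ge0.
Qed.

Lemma dirichlet0 n : dirichlet n 0 = 1 + 2 * n%:R.
Proof.
rewrite /dirichlet; under eq_bigr do rewrite mulr0 cos0 mulr1.
by rewrite sumr_const_nat subn1 /= mulr_natr.
Qed.

Lemma fejer0 n : fejer n 0 = n.+1%:R.
Proof.
rewrite /fejer; under eq_bigr do rewrite dirichlet0.
have -> : \sum_(0 <= j < n.+1) (1 + 2 * j%:R) = n.+1%:R ^+ 2 :> R.
  elim: (n.+1) => [|m IH]; first by rewrite big_geq// expr0n.
  by rewrite big_nat_recr//= IH -natr1; ring.
by rewrite expr2 mulrA mulVf ?mul1r// pnatr_eq0.
Qed.

Lemma sin_half_ge u : `|u| <= 2 -> u ^+ 2 / 16 <= sin (u / 2) ^+ 2.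
Proof.
move=> u2; have := @sqr_sin_ge R (u / 2); rewrite normrM [`|2^-1|]ger0_norm//.
have -> : (u / 2) ^+ 2 / 4 = u ^+ 2 / 16 by field.
by apply; lra.
Qed.

Lemma sin_half_neq0 u : u != 0 -> `|u| <= 2 -> sin (u / 2) != 0.
Proof.
move=> u0 /sin_half_ge h; rewrite -sqrf_eq0 gt_eqF//.
by apply: lt_le_trans h; rewrite divr_gt0// exprn_even_gt0.
Qed.

Lemma fejer_ge0_near n u : `|u| <= 2 -> 0 <= fejer n u.
Proof.
have [->|u0] := eqVneq u 0; first by rewrite fejer0.
by move=> u2; apply/fejer_ge0/sin_half_neq0.
Qed.

Lemma fejer_le_near n u x : 0 < x -> x <= `|u| -> `|u| <= 2 ->
  fejer n u <= 16 / x ^+ 2 / n.+1%:R.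
Proof.
move=> x0 xu u2; have u0 : u != 0 by rewrite -normr_gt0 (lt_le_trans x0).
apply: (le_trans (fejer_le n (sin_half_neq0 u0 u2))).
rewrite -[leRHS]invrK lef_pV2 ?posrE ?invr_gt0 ?divr_gt0 ?exprn_gt0//; last first.
  by rewrite mulr_gt0// exprn_even_gt0//= sin_half_neq0.
have -> : (16 / x ^+ 2 / n.+1%:R)^-1 = n.+1%:R * (x ^+ 2 / 16).
  by field; rewrite (gt_eqF x0) addrC natr1 pnatr_eq0.
rewrite ler_wpM2l//; apply: le_trans (sin_half_ge u2).
by rewrite ler_wpM2r// -[u ^+ 2]real_normK ?num_real// lerXn2r ?nnegrE// ltW.
Qed.

Lemma is_derive_sum_seq (I : Type) (s : seq I) (F : I -> R -> R) (dF : I -> R) x :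
  (forall i, is_derive x 1 (F i) (dF i)) ->
  is_derive x 1 (fun x => \sum_(i <- s) F i x) (\sum_(i <- s) dF i).
Proof.
move=> h; elim: s => [|i s IH].
  under eq_fun do rewrite big_nil; rewrite big_nil; exact: is_derive_cst.
rewrite big_cons.
have -> : (fun x => \sum_(j <- i :: s) F j x) = F i + (fun x => \sum_(j <- s) F j x).
  by apply/funext => y; rewrite big_cons.
exact: is_deriveD.
Qed.

Lemma is_derive_mulc (c : R) (f : R -> R) x df : is_derive x 1 f df ->
  is_derive x 1 (fun x => c * f x) (c * df).
Proof. by move=> h; apply: (@is_deriveZ R R R f c x 1 df h). Qed.

Lemma is_derive_sinM (c x : R) : is_derive x 1 (fun v => sin (c * v)) (c * cos (c * x)).
Proof.
rewrite mulrC; apply: (@is_derive1_comp _ sin ( *%R c) x).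
by have := is_derive_mulc c (is_derive_id x 1); rewrite mulr1.
Qed.

Lemma is_derive_cosM (c x : R) : is_derive x 1 (fun v => cos (c * v)) (- (c * sin (c * x))).
Proof.
rewrite -mulrN mulrC; apply: (@is_derive1_comp _ cos ( *%R c) x).
by have := is_derive_mulc c (is_derive_id x 1); rewrite mulr1.
Qed.

Lemma is_derive_fejer_primitive n v :
  is_derive v 1 (fejer_primitive n) (fejer n v).
Proof.
have -> : fejer n v = 1 + n.+1%:R^-1 * \sum_(0 <= j < n.+1)
    \sum_(1 <= k < j.+1) 2 * (k%:R^-1 * (k%:R * cos (k%:R * v))).
  rewrite /fejer; under eq_bigr do rewrite /dirichlet.
  rewrite big_split/= sumr_const_nat subn0 mulrDr -[_ *+ _]mulr_natr mul1r.
  rewrite mulVf ?pnatr_eq0//; congr (_ + _ * _); apply: eq_bigr => j _.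
  rewrite big_nat [RHS]big_nat; apply: eq_bigr => k /andP[k0 _].
  by rewrite mulKf// pnatr_eq0 -lt0n.
apply: (@is_deriveD _ _ _ id).
apply: is_derive_mulc; apply: is_derive_sum_seq => j.
apply: is_derive_sum_seq => k.
by do 2!apply: is_derive_mulc; exact: is_derive_sinM.
Qed.

Lemma sin_nat_pi n : sin (n%:R * pi) = 0 :> R.
Proof.
elim: n => [|n IH]; first by rewrite mul0r sin0.
by rewrite -natr1 mulrDl mul1r sinD IH sinpi mul0r mulr0 addr0.
Qed.

Lemma fejer_primitive_pi n : fejer_primitive n pi = pi.
Proof.
rewrite /fejer_primitive big1 ?mulr0 ?addr0// => j _.
by rewrite big1// => k _; rewrite sin_nat_pi !mulr0.
Qed.

Lemma fejer_primitiveN n v : fejer_primitive n (- v) = - fejer_primitive n v.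
Proof.
rewrite /fejer_primitive opprD; congr (_ + _).
rewrite -mulrN -sumrN; congr (_ * _); apply: eq_bigr => j _.
by rewrite -sumrN; apply: eq_bigr => k _; rewrite mulrN sinN !mulrN.
Qed.

Lemma fejer_primitive0 n : fejer_primitive n 0 = 0.
Proof.
rewrite /fejer_primitive big1 ?mulr0 ?addr0// => j _.
by rewrite big1// => k _; rewrite mulr0 sin0 !mulr0.
Qed.


Lemma is_derive_continuous (f df : R -> R) : (forall x, is_derive x 1 f (df x)) ->
  continuous f.
Proof.
move=> h x; apply: differentiable_continuous; apply/derivable1_diffP.
exact: (@ex_derive R R R x 1 f (df x) (h x)).
Qed.

Lemma fejer_primitive_MVT n v v' : v <= v' -> exists2 c, v <= c <= v' &
  fejer_primitive n v' - fejer_primitive n v = fejer n c * (v' - v).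
Proof.
move=> vv'; have [|c] := @MVT_segment R (fejer_primitive n) (fejer n) v v' vv'
    (fun x _ => is_derive_fejer_primitive n x).
  exact/continuous_subspaceT/(is_derive_continuous (is_derive_fejer_primitive n)).
by rewrite in_itv/= => cv ->; exists c.
Qed.

Lemma sin_half_gt0 (c : R) : 0 < c <= pi -> 0 < sin (c / 2).
Proof. by move=> c0; apply: sin_gt0_pi; have := @pi_gt0 R; lra. Qed.

(** The kernel is nonnegative, so the primitive increases from 0 at 0 to [pi] at [pi]. *)
Lemma fejer_primitive_bounds n v : 0 <= v <= pi -> 0 <= fejer_primitive n v <= pi.
Proof.
move=> /andP[v0 vp].
have F c : 0 <= c <= pi -> 0 <= fejer n c.
  move=> /andP[]; rewrite le_eqVlt => /predU1P[<- _|c0 cp]; first by rewrite fejer0.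
  by apply: fejer_ge0; rewrite gt_eqF// sin_half_gt0// c0.
apply/andP; split.
  have [c /andP[cv cv']] := fejer_primitive_MVT n v0.
  rewrite fejer_primitive0 !subr0 => ->.
  by rewrite mulr_ge0// F// cv (le_trans cv').
have [c /andP[cv cv']] := fejer_primitive_MVT n vp.
rewrite fejer_primitive_pi -subr_ge0 => ->.
by rewrite mulr_ge0 ?subr_ge0// F// cv' (le_trans v0).
Qed.

Lemma fejer_primitive_norm_le n v : `|v| <= pi -> `|fejer_primitive n v| <= pi.
Proof.
wlog v0 : v / 0 <= v => [hw|].
  have [/hw//|/ltW v0] := leP 0 v.
  by move=> vp; rewrite -normrN -fejer_primitiveN hw ?oppr_ge0 ?normrN.
rewrite ger0_norm// => vp; have := @fejer_primitive_bounds n v.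
by rewrite v0 vp => /(_ isT) /andP[h1 h2]; rewrite ger0_norm.
Qed.

Lemma cvg_invn : (n.+1%:R^-1 : R) @[n --> \oo] --> 0.
Proof. exact: cvg_harmonic. Qed.

(** The missing part [pi - fejer_primitive n v] is the kernel's mass on [[v, pi]]. There
    [sin (c / 2) >= sin (v / 2)], so the kernel is [O(1/n)]. *)
Lemma fejer_primitive_cvg v : 0 < v <= pi ->
  fejer_primitive n v @[n --> \oo] --> pi.
Proof.
move=> /andP[v0 vp].
pose s := sin (v / 2); have s0 : 0 < s by rewrite sin_half_gt0// v0.
have B n : pi - pi / s ^+ 2 * n.+1%:R^-1 <= fejer_primitive n v <= pi.
  have /andP[_ ->] := @fejer_primitive_bounds n v ltac:(by rewrite ltW).
  rewrite andbT lerBlDr -lerBlDl.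
  have [c /andP[cv cv']] := fejer_primitive_MVT n vp.
  rewrite fejer_primitive_pi => ->.
  have c0 : 0 < sin (c / 2) by rewrite sin_half_gt0// cv' (lt_le_trans v0).
  have sc : s <= sin (c / 2).
    have p0 := @pi_gt0 R.
    rewrite /s leNgt ltr_sin ?in_itv/=; [|lra|lra].
    by rewrite -leNgt ler_pM2r.
  have fc : fejer n c <= s ^- 2 * n.+1%:R^-1.
    apply: (le_trans (fejer_le n (lt0r_neq0 c0))).
    rewrite -invfM mulrC lef_pV2 ?posrE ?mulr_gt0 ?exprn_gt0//.
    by rewrite ler_wpM2r// lerXn2r ?nnegrE ?(ltW s0) ?(ltW c0).
  have -> : pi / s ^+ 2 / n.+1%:R = s ^- 2 / n.+1%:R * pi by ring.
  rewrite ler_pM// ?subr_ge0//; first by apply/fejer_ge0/lt0r_neq0.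
  by rewrite gerBl ltW.
apply: (@squeeze_cvgr _ _ _ _ (fun n => pi - pi / s ^+ 2 * n.+1%:R^-1) (cst pi)).
- by apply: nearW.
- rewrite -[X in _ --> X]subr0 -[X in _ - X](mulr0 (pi / s ^+ 2)).
  by apply: cvgB; [exact: cvg_cst|apply: cvgMr; exact: cvg_invn].
- exact: cvg_cst.
Qed.

End FejerKernel.

(** * Uniformly convergent series and limits of integrals *)

Section UniformLimits.
Variable R : realType.

Lemma continuous_sum_seq (I : Type) (s : seq I) (h : I -> R -> R) :
  (forall i, continuous (h i)) -> continuous (fun y => \sum_(i <- s) h i y).
Proof.
move=> ch; elim: s => [|i s IH].
  by under eq_fun do rewrite big_nil; exact: cst_continuous.
under eq_fun do rewrite big_cons.
by move=> y; apply: cvgD; [exact: ch|exact: IH].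
Qed.

Lemma norm_sum_series_le (a : nat -> R) (h : nat -> R -> R) m n y :
  (forall k y, `|h k y| <= a k) ->
  `|\sum_(m <= k < n) h k y| <= \sum_(m <= k < n) a k.
Proof.
by move=> ha; rewrite (le_trans (ler_norm_sum _ _ _))//; apply: ler_sum.
Qed.

(** The Weierstrass M-test: the remainder at [n] is at most [limn T - T n], uniformly in [y]. It
    serves both the Fourier series and the Weierstrass functions. *)
Lemma summable_continuous_series (a : nat -> R) (h : nat -> R -> R) (B : R) :
  (forall k y, `|h k y| <= a k) -> (forall n, \sum_(1 <= k < n) a k <= B) ->
  (forall k, continuous (h k)) ->
  exists2 H : R -> R, continuous H &
    forall y, \sum_(1 <= k < n.+1) h k y @[n --> \oo] --> H y.
Proof.
move=> ha aB ch.
have a0 k : 0 <= a k by apply: le_trans (ha k 0).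
pose T n := \sum_(1 <= k < n.+1) a k.
pose s y n := \sum_(1 <= k < n.+1) h k y.
have Ts n m : (n <= m)%N -> T m = T n + \sum_(n.+1 <= k < m.+1) a k.
  by move=> nm; rewrite /T (@big_cat_nat _ _ _ n.+1).
have ss y n m : (n <= m)%N -> s y m - s y n = \sum_(n.+1 <= k < m.+1) h k y.
  by move=> nm; rewrite /s (@big_cat_nat _ _ _ n.+1)//= addrAC subrr add0r.
have ndT : nondecreasing_seq T.
  by move=> n m nm; rewrite (Ts n m nm) lerDl sumr_ge0.
have cT : cvgn T.
  by apply: nondecreasing_is_cvgn => //; exists B => _ [n _ <-]; exact: aB.
have sT y n m : (n <= m)%N -> `|s y m - s y n| <= limn T - T n.
  move=> nm; rewrite ss// (le_trans (norm_sum_series_le _ _ _ ha))//.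
  rewrite lerBrDl -Ts//; exact: nondecreasing_cvgn_le.
have cs y : cvgn (s y).
  apply/cauchy_cvgP/cauchyP => e e0.
  have /cvgrPdist_lt /(_ _ e0)[n _ hn] := cT.
  exists (s y n); exists n => // m /= nm; rewrite /ball/= distrC.
  apply: le_lt_trans (sT y n m nm) _.
  by have := hn n (leqnn n); apply: le_lt_trans; exact: ler_norm.
exists (fun y => limn (s y)); last by move=> y; exact: cs.
have sH y n : `|limn (s y) - s y n| <= limn T - T n.
  have c : `|s y m - s y n| @[m --> \oo] --> `|limn (s y) - s y n|.
    by apply: cvg_norm; apply: cvgB; [exact: cs|exact: cvg_cst].
  rewrite -(cvg_lim _ c)//; apply: limr_le; first by apply: cvgP c.
  by exists n => // m /= nm; exact: sT.
move=> x; apply/cvgrPdist_le => e e0.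
have e3 : 0 < e / 3 by rewrite divr_gt0.
have /cvgrPdist_le /(_ _ e3)[n _ /(_ n (leqnn n)) hn] := cT.
have cn : continuous (fun y => s y n) by exact: continuous_sum_seq.
have /cvgrPdist_le /(_ _ e3) := cn x; apply: filterS => y hy.
have hx := sH x n; have hy' := sH y n.
have hn' : limn T - T n <= e / 3 by apply: le_trans hn; exact: ler_norm.
have -> : limn (s x) - limn (s y) =
  (limn (s x) - s x n) + (s x n - s y n) - (limn (s y) - s y n) by ring.
rewrite (le_trans (ler_normB _ _))//.
have := ler_normD (limn (s x) - s x n) (s x n - s y n); lra.
Qed.

Lemma Rintegral_bounded_cvg (D : set R) (F : nat -> R -> R) (g : R -> R) (C : R) :
  measurable D -> (@lebesgue_measure R D < +oo)%E ->
  (forall n, measurable_fun setT (F n)) -> measurable_fun setT g ->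
  (forall n x, D x -> `|F n x| <= C) -> (forall x, D x -> F n x @[n --> \oo] --> g x) ->
  \int[@lebesgue_measure R]_(x in D) F n x @[n --> \oo] -->
  \int[@lebesgue_measure R]_(x in D) g x.
Proof.
move=> mD Doo mF mg FC Fg.
have iC : (@lebesgue_measure R).-integrable D (EFin \o cst C).
  by apply: measurable_bounded_integrable => //; exists `|C|; split => // y Cy x _ /=; rewrite ltW.
have [||x|x n|ig _ h] := @dominated_convergence _ _ R (@lebesgue_measure R) D mD
  (fun n => EFin \o F n) (EFin \o g) (EFin \o cst C) _ _ (aeW _ _) iC (aeW _ _).
- move=> n; apply: (measurableT_comp (@EFin_measurable R setT)).
  by apply: measurable_funTS; exact: mF.
- by apply: (measurableT_comp (@EFin_measurable R setT)); exact: measurable_funTS.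
- by move=> Dx; apply: cvg_EFin; [exact: nearW|exact: Fg].
- by move=> Dx; rewrite /= lee_fin FC.
by apply: fine_cvg; rewrite fineK//; exact: integrable_fin_num.
Qed.

Lemma fejer_primitive_cvg_sg (v : R) : `|v| <= pi ->
  fejer_primitive n v @[n --> \oo] --> pi * Num.sg v.
Proof.
move=> vp; have [v0|v0|->] := ltrgt0P v.
- rewrite gtr0_sg// mulr1; apply: fejer_primitive_cvg.
  by rewrite v0 (le_trans (ler_norm _)).
- rewrite ltr0_sg// mulrN1; rewrite -[v]opprK.
  under eq_fun do rewrite fejer_primitiveN.
  apply: cvgN; apply: fejer_primitive_cvg.
  by rewrite oppr_gt0 v0 (le_trans _ vp)// -normrN ler_norm.
- rewrite sgr0 mulr0; under eq_fun do rewrite fejer_primitive0; exact: cvg_cst.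
Qed.

End UniformLimits.

(** * Fourier inversion for the occupation measure *)

Section FourierInversion.
Variables (R : realType) (f : R -> R) (l B : R).
Hypothesis l_gt0 : 0 < l.
Hypothesis mf : measurable_fun setT f.
Hypothesis f_le : forall x, `|f x| <= l / 2.
Notation mu := (@lebesgue_measure R).

Let A k : R := cos_coef f (k%:R / l).
Let S k : R := sin_coef f (k%:R / l).
Hypothesis fourier_le : forall n, \sum_(1 <= k < n) (`|A k| + `|S k|) <= B.

(** The frequencies [k] and [-k] together, in the Fourier series of period [2 pi l], normalised so
    that the constant term is 1: the full sum is [2 pi l] times the density on the central
    period. *)
Definition fourier_term (k : nat) (y : R) : R :=
  2 * (cos (k%:R / l * y) * A k + sin (k%:R / l * y) * S k).

Lemma fourier_term_le k y : `|fourier_term k y| <= 2 * (`|A k| + `|S k|).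
Proof.
rewrite /fourier_term normrM [`|2|]ger0_norm// ler_wpM2l//.
rewrite (le_trans (ler_normD _ _))// !normrM lerD// ler_piMl ?normr_ge0 ?cos_max ?sin_max//.
Qed.

Lemma fourier_bound_sum n : \sum_(1 <= k < n) 2 * (`|A k| + `|S k|) <= 2 * B.
Proof. by rewrite -mulr_sumr ler_wpM2l. Qed.

Lemma continuous_fourier_term k : continuous (fourier_term k).
Proof.
have h (c : R) : continuous (fun y : R => c * y).
  by move=> y; apply: cvgMr; exact: cvg_id.
move=> y; apply: cvgMr; apply: cvgD; apply: cvgMl.
  by apply: continuous_comp; [exact: h|exact: continuous_cos].
by apply: continuous_comp; [exact: h|exact: continuous_sin].
Qed.

Definition fourier_sum n y := 1 + \sum_(1 <= k < n.+1) fourier_term k y.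
Definition fourier_mean n y := n.+1%:R^-1 * \sum_(0 <= j < n.+1) fourier_sum j y.

Let f_sub y x := (f x - y) / l.

Let bounded_measurable_f_sub y : bounded_measurable (f_sub y).
Proof.
apply: bounded_measurableM; last exact: bounded_measurable_cst.
apply: bounded_measurableD; last exact: bounded_measurable_cst.
by split => //; exists (l / 2).
Qed.

Let measurable_f_sub y (c : R) : measurable_fun setT (fun x => c * f_sub y x).
Proof. by have [h _] := bounded_measurableZ c (bounded_measurable_f_sub y). Qed.

Let bounded_measurable_dirichlet n y :
  bounded_measurable (fun x => dirichlet n (f_sub y x)).
Proof.
apply: bounded_measurableD; first exact: bounded_measurable_cst.
apply: bounded_measurable_sum => k; apply: bounded_measurableZ.
exact: bounded_measurable_cos.
Qed.

Let bounded_measurable_fejer n y :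
  bounded_measurable (fun x => fejer n (f_sub y x)).
Proof. by apply: bounded_measurableZ; exact: bounded_measurable_sum. Qed.

Let bounded_measurable_sin_sum n y : bounded_measurable (fun x =>
  \sum_(0 <= j < n) \sum_(1 <= k < j.+1) 2 * (k%:R^-1 * sin (k%:R * f_sub y x))).
Proof.
apply: bounded_measurable_sum => j; apply: bounded_measurable_sum => k.
by do 2!apply: bounded_measurableZ; exact: bounded_measurable_sin.
Qed.

Let bounded_measurable_primitive n y :
  bounded_measurable (fun x => fejer_primitive n (f_sub y x)).
Proof. by apply: bounded_measurableD => //; exact: bounded_measurableZ. Qed.

Lemma mean_dirichlet n y : mean (fun x => dirichlet n (f_sub y x)) = fourier_sum n y.
Proof.
have h k : bounded_measurable (fun x => 2 * cos (k%:R * f_sub y x)).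
  by apply: bounded_measurableZ; exact: bounded_measurable_cos.
rewrite /dirichlet meanD; [|exact: bounded_measurable_cst|exact: bounded_measurable_sum].
rewrite mean_cst mean_sum//; congr (_ + _); apply: eq_bigr => k _.
rewrite meanZ; last exact: bounded_measurable_cos.
rewrite /fourier_term -mean_cosB//; congr (_ * mean _); apply/funext => x.
by rewrite -cosN /f_sub; congr cos; field; rewrite gt_eqF.
Qed.

(** Written as kernel averages, the Cesaro means inherit positivity and decay from the kernel. *)
Lemma mean_fejer n y : mean (fun x => fejer n (f_sub y x)) = fourier_mean n y.
Proof.
rewrite /fejer meanZ; last exact: bounded_measurable_sum.
by rewrite mean_sum//; under eq_bigr do rewrite mean_dirichlet.
Qed.

(** The mean over [x] of [fejer_primitive n (f_sub y x)], expanded to a finite sum so that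
    differentiating in [y] needs no exchange with the integral. *)
Definition fourier_primitive n y := mean f / l - y / l + n.+1%:R^-1 *
  \sum_(0 <= j < n.+1) \sum_(1 <= k < j.+1)
    2 * (k%:R^-1 * (S k * cos (k%:R / l * y) - A k * sin (k%:R / l * y))).

Lemma mean_fejer_primitive n y :
  mean (fun x => fejer_primitive n (f_sub y x)) = fourier_primitive n y.
Proof.
have hs k : bounded_measurable (fun x => sin (k%:R * f_sub y x)).
  exact: bounded_measurable_sin.
have hk k : bounded_measurable (fun x => 2 * (k%:R^-1 * sin (k%:R * f_sub y x))).
  by do 2!apply: bounded_measurableZ.
have bf : bounded_measurable f by split => //; exists (l / 2).
rewrite /fejer_primitive meanD//; last exact: bounded_measurableZ.
congr (_ + _).
  rewrite /f_sub.
  have -> : (fun x => (f x - y) / l) = (fun x => l^-1 * f x + cst (- (y / l)) x).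
    by apply/funext => x /=; rewrite mulrBl mulrC.
  by rewrite meanD ?meanZ ?mean_cst 1?mulrC//; [exact: bounded_measurableZ|exact: bounded_measurable_cst].
rewrite meanZ// mean_sum; last by move=> j; exact: bounded_measurable_sum.
congr (_ * _); apply: eq_bigr => j _; rewrite mean_sum//; apply: eq_bigr => k _.
rewrite meanZ; last exact: bounded_measurableZ.
rewrite meanZ//; congr (_ * (_ * _)).
rewrite [S k * _]mulrC [A k * _]mulrC -mean_sinB//; congr mean; apply/funext => x.
by rewrite /f_sub; congr sin; field; rewrite gt_eqF.
Qed.

Lemma is_derive_fourier_primitive n (y : R) :
  is_derive y 1 (fourier_primitive n) (- l^-1 * fourier_mean n y).
Proof.
have -> : - l^-1 * fourier_mean n y = (0 - l^-1) + n.+1%:R^-1 *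
  \sum_(0 <= j < n.+1) \sum_(1 <= k < j.+1)
    2 * (k%:R^-1 * (S k * - (k%:R / l * sin (k%:R / l * y)) -
                    A k * (k%:R / l * cos (k%:R / l * y)))).
  rewrite /fourier_mean /fourier_sum big_split/= sumr_const_nat subn0 -[_ *+ _]mulr_natr mul1r.
  rewrite mulrDr mulVf ?pnatr_eq0// mulrDr mulr1 sub0r; congr (_ + _).
  rewrite mulrCA; congr (_ * _); rewrite mulr_sumr; apply: eq_bigr => j _.
  rewrite mulr_sumr [LHS]big_nat [RHS]big_nat; apply: eq_bigr => k /andP[k0 _].
  rewrite /fourier_term; field.
  by rewrite (gt_eqF l_gt0) pnatr_eq0 -lt0n k0.
apply: (@is_deriveD R R R (fun y : R => mean f / l - y / l)); last first.
  apply: is_derive_mulc; apply: is_derive_sum_seq => j; apply: is_derive_sum_seq => k.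
  do 2!apply: is_derive_mulc.
  apply: (@is_deriveB R R R (fun y : R => S k * cos (k%:R / l * y))).
    by apply: is_derive_mulc; exact: is_derive_cosM.
  by apply: is_derive_mulc; exact: is_derive_sinM.
apply: (@is_deriveB R R R (fun y : R => mean f / l)).
under eq_fun do rewrite mulrC.
by have := is_derive_mulc l^-1 (is_derive_id y 1); rewrite mulr1.
Qed.

Lemma continuous_fourier_mean n : continuous (fourier_mean n).
Proof.
move=> y; apply: cvgMr; apply: (@continuous_sum_seq R _ _ fourier_sum) => j {}y.
apply: cvgD; first exact: cvg_cst.
by apply: (@continuous_sum_seq R _ _ fourier_term); exact: continuous_fourier_term.
Qed.

Lemma fourier_mean_le n y : `|fourier_mean n y| <= 1 + 2 * B.
Proof.
have h j : `|fourier_sum j y| <= 1 + 2 * B.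
  rewrite (le_trans (ler_normD _ _))// normr1 lerD2l.
  by apply: le_trans (fourier_bound_sum j.+1); apply: norm_sum_series_le; exact: fourier_term_le.
rewrite /fourier_mean normrM ger0_norm ?invr_ge0// ler_pdivrMl ?ltr0n//.
rewrite (le_trans (ler_norm_sum _ _ _))//.
apply: (@le_trans _ _ (\sum_(0 <= j < n.+1) (1 + 2 * B))).
  by apply: ler_sum.
by rewrite sumr_const_nat subn0 -[_ *+ _]mulr_natl.
Qed.

Lemma Rintegral_fourier_mean n p q : p < q ->
  \int[mu]_(y in `[p, q]) fourier_mean n y = l * (fourier_primitive n p - fourier_primitive n q).
Proof.
move=> pq; rewrite /Rintegral.
have dF (y : R) : is_derive y 1 (fun y => - l * fourier_primitive n y) (fourier_mean n y).
  have := is_derive_mulc (- l) (is_derive_fourier_primitive n y).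
  by rewrite mulrA mulrNN divff ?mul1r// gt_eqF.
have cF := is_derive_continuous dF.
rewrite (@continuous_FTC2 _ _ (fun y => - l * fourier_primitive n y))//=.
- by ring.
- exact/continuous_subspaceT/continuous_fourier_mean.
- split.
  + by move=> y _; exact: (@ex_derive R R R y 1 _ _ (dF y)).
  + by apply: cvg_at_right_filter; exact: cF.
  + by apply: cvg_at_left_filter; exact: cF.
- by move=> y _; rewrite derive1E; exact: (@derive_val R R R y 1 _ _ (dF y)).
Qed.


Variable H : R -> R.
Hypothesis H_continuous : continuous H.
Hypothesis H_cvg : forall y, \sum_(1 <= k < n.+1) fourier_term k y @[n --> \oo] --> H y.

Let mean_cvg (F : nat -> R -> R) (g : R -> R) (C : R) :
  (forall n, measurable_fun setT (F n)) -> measurable_fun setT g ->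
  (forall n x, `|F n x| <= C) -> (forall x, F n x @[n --> \oo] --> g x) ->
  mean (F n) @[n --> \oo] --> mean g.
Proof.
move=> mF mg FC Fg; apply: (@Rintegral_bounded_cvg R _ _ _ C) => //.
by rewrite lebesgue_measure_itv/= lte01 -EFinD ltry.
Qed.

Lemma fourier_mean_cvg y : fourier_mean n y @[n --> \oo] --> 1 + H y.
Proof.
have h : fourier_sum n y @[n --> \oo] --> 1 + H y.
  by apply: cvgD; [exact: cvg_cst|exact: H_cvg].
have := cesaro h; rewrite /arithmetic_mean.
by under eq_fun do rewrite /series/=.
Qed.

(** The quotient is in fact at most [3/2]. The bound 2 keeps it in [[-pi, pi]] and in the range of
    the sine estimates, so the only singularity of the kernel met is at [f x = y]. *)
Let f_sub_le (y x : R) : `|y| <= l -> `|f_sub y x| <= 2.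
Proof.
move=> yl; rewrite /f_sub normrM normfV (ger0_norm (ltW l_gt0)) ler_pdivrMr//.
rewrite (le_trans (ler_normB _ _))// (@le_trans _ _ (l / 2 + l))//.
  by rewrite lerD.
by move: l_gt0; lra.
Qed.

Let fourier_mean_ge0 n (y : R) : `|y| <= l -> 0 <= fourier_mean n y.
Proof.
move=> yl; rewrite -mean_fejer; apply: Rintegral_ge0 => x _.
exact/fejer_ge0_near/f_sub_le.
Qed.

Lemma density_ge0 (y : R) : `|y| <= l -> 0 <= 1 + H y.
Proof.
move=> yl; have h := @fourier_mean_cvg y.
rewrite -(cvg_lim _ h)//; apply: limr_ge; first by apply: cvgP h.
by apply: nearW => n; exact: fourier_mean_ge0.
Qed.

(** Such a [y] is at distance at least [|y| - l/2] from all values of [f], where the kernel is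
    [O(1/n)] uniformly. *)
Lemma density_eq0 (y : R) : l / 2 < `|y| -> `|y| <= l -> 1 + H y = 0.
Proof.
move=> ly yl; have h := @fourier_mean_cvg y.
rewrite -(cvg_lim _ h)//; apply: cvg_lim => //.
pose e := (`|y| - l / 2) / l.
have e0 : 0 < e by rewrite divr_gt0// subr_gt0.
apply: (@squeeze_cvgr _ _ _ _ (cst 0) (fun n => 16 / e ^+ 2 * n.+1%:R^-1)).
- apply: nearW => n; rewrite fourier_mean_ge0//= -mean_fejer; apply: mean_le => // x _.
  apply: fejer_le_near => //; last exact: f_sub_le.
  rewrite /e /f_sub normrM normfV (ger0_norm (ltW l_gt0)) ler_wpM2r ?invr_ge0 ?(ltW l_gt0)//.
  rewrite distrC; have := lerB_dist y (f x); have := f_le x; lra.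
- exact: cvg_cst.
- rewrite -[X in _ --> X](mulr0 (16 / e ^+ 2)); apply: cvgMr; exact: cvg_invn.
Qed.

Let measurable_f_preimage (D : set R) : measurable D -> measurable [set x | D (f x)].
Proof. by move=> mD; rewrite -[X in measurable X]setTI; exact: mf. Qed.

Let bounded_measurable_indic_f (D : set R) : measurable D ->
  bounded_measurable (\1_[set x | D (f x)] : R -> R).
Proof. by move=> mD; apply: bounded_measurable_indic; exact: measurable_f_preimage. Qed.

(** The kernel is [n + 1] at 0, so an atom of mass [m] would force the Cesaro mean at [y] to be at
    least [(n + 1) m], against the uniform bound [1 + 2 B]. *)
Lemma mean_atom (y : R) : `|y| <= l -> mean (\1_[set x | [set y] (f x)]) = 0.
Proof.
move=> yl; apply/eqP; rewrite eq_le; apply/andP; split; last first.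
  by apply: Rintegral_ge0 => x _; rewrite indicE.
set m := mean _.
have h n : n.+1%:R * m <= 1 + 2 * B.
  apply: le_trans (le_trans (ler_norm _) (fourier_mean_le n y)).
  rewrite -mean_fejer -meanZ; last exact: bounded_measurable_indic_f.
  apply: le_mean => // [|x _].
    by apply: bounded_measurableZ; exact: bounded_measurable_indic_f.
  rewrite indicE; have [xy|xy] := boolP (x \in _); last first.
    by rewrite mulr0 fejer_ge0_near// f_sub_le.
  by move: xy; rewrite /f_sub inE/= => ->; rewrite subrr mul0r fejer0 mulr1.
rewrite leNgt; apply/negP => m0.
have := h (Num.truncn ((1 + 2 * B) / m)).
by rewrite leNgt -ltr_pdivrMr// truncnS_gt.
Qed.

(** The Cesaro means are integrated over [[p, q]] and the limit is taken twice: bounded convergence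
    gives the left side, while the primitive at the endpoints tends to averages of
    [pi * sg (f x - y)], which count the mass beyond [p] and beyond [q]. *)
Lemma mean_itv (p q : R) : `|p| <= l -> `|q| <= l -> p < q ->
  \int[mu]_(y in `[p, q]) (1 + H y) = 2 * pi * l * mean (\1_[set x | `]p, q]%classic (f x)]).
Proof.
move=> pl ql pq.
have mfm n : measurable_fun setT (fourier_mean n).
  by apply: continuous_measurable_fun; exact: continuous_fourier_mean.
have mH : measurable_fun setT (fun y => 1 + H y).
  apply: measurable_funD; first exact: measurable_cst.
  exact: continuous_measurable_fun.
have h1 : \int[mu]_(y in `[p, q]) fourier_mean n y @[n --> \oo] -->
    \int[mu]_(y in `[p, q]) (1 + H y).
  apply: (@Rintegral_bounded_cvg R _ _ _ (1 + 2 * B)) => //.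
  - by rewrite lebesgue_measure_itv/= lte_fin pq -EFinD ltry.
  - by move=> n y _; exact: fourier_mean_le.
  - by move=> y _; exact: fourier_mean_cvg.
rewrite -(cvg_lim _ h1)//; apply: cvg_lim => //.
under eq_fun do rewrite Rintegral_fourier_mean//.
pose J y x : R := \1_[set x | `]y, +oo[%classic (f x)] x.
pose At y x : R := \1_[set x | [set y] (f x)] x.
have bJ y : bounded_measurable (J y) by exact: bounded_measurable_indic_f.
have bA y : bounded_measurable (At y) by exact: bounded_measurable_indic_f.
have b1 y : bounded_measurable (fun x => 2 * J y x + At y x).
  by apply: bounded_measurableD => //; exact: bounded_measurableZ.
have b2 y : bounded_measurable (fun x => 2 * J y x + At y x + cst (-1) x).
  by apply: bounded_measurableD => //; exact: bounded_measurable_cst.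
(* The sign in terms of indicators; the atom term has mean zero by [mean_atom]. *)
have sgE y x : Num.sg (f_sub y x) = 2 * J y x + At y x + cst (-1) x.
  rewrite /f_sub sgrM [Num.sg l^-1]gtr0_sg ?invr_gt0// mulr1 /J /At !indicE.
  have -> : (x \in [set x | `]y, +oo[%classic (f x)]) = (y < f x).
    by apply/idP/idP; rewrite inE/= in_itv/= andbT.
  have -> : (x \in [set x | [set y] (f x)]) = (f x == y).
    by apply/idP/eqP; rewrite inE.
  have [h|h|h] := ltrgtP y (f x).
  - by rewrite gtr0_sg ?subr_gt0//=; ring.
  - by rewrite ltr0_sg ?subr_lt0//=; ring.
  - by rewrite h subrr sgr0/=; ring.
have hQ y : `|y| <= l -> fourier_primitive n y @[n --> \oo] --> pi * (2 * mean (J y) - 1).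
  move=> yl; have -> : pi * (2 * mean (J y) - 1) =
      mean (fun x => pi * (2 * J y x + At y x + cst (-1) x)).
    rewrite meanZ// meanD//; last exact: bounded_measurable_cst.
    rewrite meanD//; last exact: bounded_measurableZ.
    by rewrite meanZ// mean_cst mean_atom// addr0.
  under eq_fun do rewrite -mean_fejer_primitive.
  have yp x : `|f_sub y x| <= pi by rewrite (le_trans (f_sub_le x yl))// pi_ge2.
  apply: (@mean_cvg _ _ pi) => [n||n x|x].
  - by have [] := bounded_measurable_primitive n y.
  - by have [] := bounded_measurableZ pi (b2 y).
  - exact: fejer_primitive_norm_le.
  - by rewrite -sgE; exact: fejer_primitive_cvg_sg.
have -> : 2 * pi * l * mean (\1_[set x | `]p, q]%classic (f x)]) =
    l * (pi * (2 * mean (J p) - 1) - pi * (2 * mean (J q) - 1)).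
  have -> : mean (J p) = mean (fun x => \1_[set x | `]p, q]%classic (f x)] x + J q x).
    congr mean; apply/funext => x; rewrite /J !indicE.
    have -> : (x \in [set x | `]p, +oo[%classic (f x)]) = (p < f x).
      by apply/idP/idP; rewrite inE/= in_itv/= andbT.
    have -> : (x \in [set x | `]q, +oo[%classic (f x)]) = (q < f x).
      by apply/idP/idP; rewrite inE/= in_itv/= andbT.
    have -> : (x \in [set x | `]p, q]%classic (f x)]) = (p < f x <= q).
      by apply/idP/idP; rewrite inE/= in_itv/=.
    have [qf|fq] := ltP q (f x); first by rewrite (lt_trans pq)//= add0r.
    by rewrite andbT addr0.
  rewrite meanD//; last exact: bounded_measurable_indic_f.
  ring.
by apply: cvgMr; apply: cvgB; exact: hQ.
Qed.

End FourierInversion.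

(** * Identification of the density *)

Section OccupationDensity.
Variable R : realType.
Notation mu := (@lebesgue_measure R).

(* The unused proof arguments let the measure structure be inferred. *)
Definition density_measure (rho : R -> R) (rho_ge0 : forall y, 0 <= rho y)
  (mrho : measurable_fun setT rho) (A : set R) : \bar R :=
  (\int[mu]_(y in A) (rho y)%:E)%E.

Section DensityMeasure.
Variables (rho : R -> R) (rho_ge0 : forall y, 0 <= rho y).
Variable mrho : measurable_fun setT rho.
Local Notation nu := (density_measure rho_ge0 mrho).

Let nu0 : nu set0 = 0%E.
Proof. by rewrite /density_measure integral_set0. Qed.

Let nu_ge0 A : (0 <= nu A)%E.
Proof. by apply: integral_ge0 => y _; rewrite lee_fin. Qed.

Let nu_sigma_additive : semi_sigma_additive nu.
Proof.
move=> F mF tF mUF; rewrite /density_measure ge0_integral_bigcup//=.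
- apply: is_cvg_ereal_nneg_natsum_cond => n _ _.
  by apply: integral_ge0 => y _; rewrite lee_fin.
- by apply/measurable_EFinP; exact: measurable_funTS.
- by move=> y _; rewrite lee_fin.
Qed.

HB.instance Definition _ := isMeasure.Build _ _ _ nu nu0 nu_ge0 nu_sigma_additive.

End DensityMeasure.

Definition occupation_measure (f : R -> R) (mf : measurable_fun setT f) : set R -> \bar R :=
  occupation f.

Section OccupationMeasure.
Variables (f : R -> R) (mf : measurable_fun setT f).
Local Notation nu := (occupation_measure mf).

Let preE A : [set x | `[0%R, 1%R[%classic x /\ A (f x)] = `[0, 1[ `&` f @^-1` A.
Proof. by []. Qed.

Let measurable_pre A : measurable A -> measurable (`[0, 1[ `&` f @^-1` A).
Proof.
by move=> mA; apply: measurableI => //; rewrite -[X in measurable X]setTI; exact: mf.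
Qed.

Let nu0 : nu set0 = 0%E.
Proof. by rewrite /occupation_measure /occupation preE preimage_set0 setI0 measure0. Qed.

Let nu_ge0 A : (0 <= nu A)%E.
Proof. exact: measure_ge0. Qed.

Let nu_sigma_additive : semi_sigma_additive nu.
Proof.
move=> F mF tF mUF.
have := @measure_semi_sigma_additive _ _ _ mu (fun n => `[0, 1[ `&` f @^-1` F n).
rewrite -setI_bigcupr -preimage_bigcup; apply.
- by move=> n; exact: measurable_pre.
- apply/trivIsetP => i j _ _ ij; have /trivIsetP/(_ i j Logic.I Logic.I ij) h := tF.
  apply/seteqP; split => // x [[_ Fi] [_ Fj]].
  by have : (F i `&` F j) (f x) by []; rewrite h.
- exact: measurable_pre.
Qed.

HB.instance Definition _ := isMeasure.Build _ _ _ nu nu0 nu_ge0 nu_sigma_additive.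

End OccupationMeasure.

Lemma occupation_lty (f : R -> R) A : measurable_fun setT f -> measurable A ->
  (occupation f A < +oo)%E.
Proof.
move=> mf mA; apply: (@le_lt_trans _ _ (mu `[0, 1[%classic)).
  apply: le_measure; rewrite ?inE//; last by move=> x [].
  by apply: measurableI => //; rewrite -[X in measurable X]setTI; exact: mf.
by rewrite lebesgue_measure_itv/= lte01 -EFinD ltry.
Qed.

Lemma mean_indicE (f : R -> R) A : measurable_fun setT f -> measurable A ->
  (mean (\1_[set x | A (f x)]))%:E = occupation f A.
Proof.
move=> mf mA; rewrite /mean /Rintegral integral_indic//; last first.
  by rewrite -[X in measurable X]setTI; exact: mf.
rewrite setIC fineK// ge0_fin_numE//.
exact: occupation_lty mf mA.
Qed.

(** Half-open intervals are stable under intersection and generate the Borel sets; the intervals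
    []-n, n]] exhaust the line with finite measure. *)
Lemma measure_eq_itv_oc (m1 m2 : {measure set R -> \bar R}) :
  (forall A, measurable A -> (m1 A < +oo)%E) ->
  (forall p q, p < q -> m1 `]p, q]%classic = m2 `]p, q]%classic) ->
  forall A, measurable A -> m1 A = m2 A.
Proof.
move=> fin h A mA.
apply: (@measure_unique _ R R (@ocitv R)
  (fun n : nat => `](- n%:R)%R, n%:R]%classic) erefl _ _ _ m1 m2 _ _ A mA).
- exact: ocitvI.
- by move=> n; exists (- n%:R, n%:R) => //=; rewrite (le_trans (y := 0)) ?oppr_le0.
- apply/seteqP; split => // x _; exists (Num.truncn `|x|).+1 => //=.
  have := truncnS_gt `|x|; rewrite ltr_norml in_itv/= => /andP[-> /ltW ->].
  by [].
- move=> {mA}A [[p q] _ <-] /=; have [|qp] := ltP p q; first exact: h.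
  by rewrite set_itv_ge ?bnd_simp -?leNgt// !measure0.
- by move=> n; apply: fin; exact: measurable_itv.
Qed.

Lemma has_bdd_cont_density_of_fourier (f : R -> R) (l B : R) : 0 < l ->
  measurable_fun setT f -> (forall x, `|f x| <= l / 2) ->
  (forall n, \sum_(1 <= k < n) (`|cos_coef f (k%:R / l)| + `|sin_coef f (k%:R / l)|) <= B) ->
  has_bdd_cont_density f.
Proof.
move=> l0 mf fl fB.
have [H cH hH] := summable_continuous_series (fourier_term_le f l) (fourier_bound_sum fB)
  (fun k => @continuous_fourier_term R f l k).
(* The Fourier series has period [2 * pi * l]; the cutoff [chi] keeps the central
   period. It is harmless as the sum vanishes for [l / 2 < `|y| <= l]. *)
pose chi (y : R) : R := Num.max 0 (Num.min 1 (3 - 4 * (`|y| / l))).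
pose c : R := (2 * pi * l)^-1.
have c0 : 0 < c by rewrite invr_gt0 !mulr_gt0// pi_gt0.
pose rho y := c * (chi y * (1 + H y)).
have chi01 y : 0 <= chi y <= 1.
  by rewrite /chi le_max lexx/= ge_max ler01/= ge_min lexx.
have HB y : `|1 + H y| <= 1 + 2 * B.
  have h : `|fourier_mean f l n y| @[n --> \oo] --> `|1 + H y|.
    by apply: cvg_norm; exact: fourier_mean_cvg.
  rewrite -(cvg_lim _ h)//; apply: limr_le; first exact: cvgP h.
  by apply: nearW => n; exact: fourier_mean_le.
have rhoE y : `|y| <= l -> rho y = c * (1 + H y).
  move=> yl; rewrite /rho; congr (_ * _).
  have [yl2|yl2] := leP `|y| (l / 2); last by rewrite (density_eq0 l0 mf fl hH)// mulr0.
  have : `|y| / l <= 1 / 2 by rewrite ler_pdivrMr//; lra.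
  move=> h; rewrite /chi min_l; last lra.
  by rewrite max_r// mul1r.
have rho0 y : l <= `|y| -> rho y = 0.
  move=> ly; have : 1 <= `|y| / l by rewrite ler_pdivlMr// mul1r.
  by move=> h; rewrite /rho /chi max_l ?mul0r ?mulr0// ge_min; apply/orP; right; lra.
have rho_ge0 y : 0 <= rho y.
  have [/ltW/rho0 ->//|yl] := ltP l `|y|.
  by rewrite rhoE//; apply: mulr_ge0; [exact: ltW|exact: (density_ge0 l0 mf fl hH)].
have crho : continuous rho.
  have ch1 : continuous (fun y : R => 3 - 4 * (`|y| / l)).
    move=> y; apply: cvgB; first exact: cvg_cst.
    by apply: cvgMr; apply: cvgMl; exact: norm_continuous.
  have ch2 y : {for y, continuous (cst (1 : R) \min (fun y : R => 3 - 4 * (`|y| / l)))}.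
    by apply: continuous_min; [exact: cst_continuous|exact: ch1].
  have ch3 y : {for y, continuous chi}.
    by apply: (@continuous_max _ _ (cst (0 : R))); [exact: cst_continuous|exact: ch2].
  move=> y; apply: cvgMr; apply: cvgM; first exact: ch3.
  by apply: cvgD; [exact: cvg_cst|exact: cH].
have mrho : measurable_fun setT rho by exact: continuous_measurable_fun.
exists rho; split => //; split => //; split.
  exists (c * (1 + 2 * B)) => y; rewrite ler_wpM2l ?(ltW c0)//.
  have /andP[h0 h1] := chi01 y.
  rewrite (le_trans (ler_norm _))// normrM -[leRHS]mul1r ler_pM//.
  by rewrite ger0_norm.
suff h A : measurable A -> occupation_measure mf A = density_measure rho_ge0 mrho A.
  by move=> A; exact: h.
move: A; apply: (measure_eq_itv_oc (m1 := occupation_measure mf)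
  (m2 := density_measure rho_ge0 mrho)).
  by move=> A mA; exact: occupation_lty.
move=> p q pq.
(* The inversion formula holds for endpoints in [[-l, l]]; outside, neither [f] takes values nor is
   [rho] nonzero, so intervals may be clipped. *)
pose p' := Num.max p (- l); pose q' := Num.min q l.
have E : `]p', q']%classic = `]p, q]%classic `&` `]- l, l]%classic.
  by apply/seteqP; split => x /=; rewrite !in_itv/= /p' /q' gt_max le_min;
    [move=> /andP[/andP[-> ->] /andP[-> ->]]|move=> [/andP[-> ->] /andP[-> ->]]].
have clip_f x : `]p, q]%classic (f x) = `]p', q']%classic (f x).
  rewrite E; apply/propext; split => [h|[]//]; split => //=; rewrite in_itv/=.
  by have := fl x; rewrite ler_norml; lra.
have clip_occ : occupation f `]p, q]%classic = occupation f `]p', q']%classic.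
  by rewrite /occupation; congr (mu _); apply/eq_set => x; rewrite clip_f.
have clip_int : (\int[mu]_(y in `]p, q]) (rho y)%:E = \int[mu]_(y in `]p', q']) (rho y)%:E)%E.
  rewrite E integral_mkcondr; apply: eq_integral => y _.
  rewrite patchE; case: ifPn => //; rewrite notin_setE/= in_itv/= => yl.
  rewrite rho0// leNgt; apply/negP => yl'; apply: yl; move: yl'.
  by rewrite ltr_norml => /andP[-> /ltW ->].
suff h : occupation f `]p', q']%classic = (\int[mu]_(y in `]p', q']) (rho y)%:E)%E.
  exact: etrans clip_occ (etrans h (esym clip_int)).
have [qp|pq'] := leP q' p'.
  have -> : `]p', q']%classic = set0 by rewrite set_itv_ge// bnd_simp -leNgt.
  rewrite integral_set0 /occupation (_ : [set x | _] = set0) ?measure0//.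
  by apply/seteqP; split => // x [].
have p'l : - l <= p' by rewrite le_max lexx orbT.
have q'l : q' <= l by rewrite ge_min lexx orbT.
have pl : `|p'| <= l by rewrite ler_norml p'l (le_trans (ltW pq')).
have ql : `|q'| <= l by rewrite ler_norml q'l (le_trans p'l) ?ltW.
rewrite -mean_indicE//.
have := mean_itv l0 mf fl fB cH hH pl ql pq'.
move=> /(congr1 (fun v => c * v)); rewrite mulrA mulVf ?mul1r ?gt_eqF ?mulr_gt0 ?pi_gt0// => <-.
have iH : mu.-integrable `[p', q'] (EFin \o (fun y => 1 + H y)).
  apply: continuous_compact_integrable; first exact: segment_compact.
  by apply: continuous_subspaceT => y; apply: cvgD; [exact: cvg_cst|exact: cH].
rewrite integral_itv_obnd_cbnd; last exact: measurable_funTS (measurableT_comp _ mrho).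
rewrite -RintegralZl// /Rintegral.
rewrite fineK; last first.
  by apply: integrable_fin_num => //; exact: (integrableZl _ c iH).
apply: eq_integral => y; rewrite inE/= in_itv/= => /andP[h1 h2].
by rewrite rhoE// ler_norml (le_trans p'l)//= (le_trans h2).
Qed.

End OccupationDensity.

(** * Weierstrass functions *)

Section WeierstrassFunctions.
Variable R : realType.

Lemma lipschitz_real (g : R -> R) : lipschitz g ->
  exists2 M : R, 0 < M & forall x y, `|g x - g y| <= M * `|x - y|.
Proof.
move=> /pinfty_ex_gt0[M M0 hM]; exists M => // x y.
exact: (hM (x, y)).
Qed.

Lemma one_periodic_int (g : R -> R) (x : R) (n : int) : one_periodic g ->
  g (x + n%:~R) = g x.
Proof.
move=> pg.
have hn (m : nat) (y : R) : g (y + m%:R) = g y.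
  by elim: m => [|m IH]; rewrite ?addr0// -natr1 addrA pg.
case: n => n; first exact: hn.
by rewrite NegzE mulrNz -[in RHS](subrK (n.+1%:R) x) hn.
Qed.

Lemma one_periodic_lipschitz_bounded (g : R -> R) : one_periodic g -> lipschitz g ->
  exists2 C : R, 0 <= C & forall x, `|g x| <= C.
Proof.
move=> pg /lipschitz_real[M M0 hM]; exists (`|g 0| + M).
  by rewrite addr_ge0// ltW.
move=> x; have /andP[h1 h2] := floor_itv x.
rewrite -(one_periodic_int x (- Num.floor x) pg) mulrNz.
set y := x - _.
have y01 : `|y| <= 1 by rewrite ger0_norm /y; lra.
rewrite -[g y](subrK (g 0)) addrC (le_trans (ler_normD _ _))// lerD2l.
by rewrite (le_trans (hM _ _))// subr0 ler_piMr// ltW.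
Qed.

Lemma lipschitz_continuous_real (g : R -> R) : lipschitz g -> continuous g.
Proof.
move=> /lipschitz_real[M M0 hM] x; apply/cvgrPdist_le => e e0.
apply/nbhs_ballP; exists (e / M) => /= [|y]; first exact: divr_gt0.
rewrite /ball/= ltr_pdivlMr// mulrC => /ltW; exact: le_trans.
Qed.

Lemma bounded_measurable_weierstrass (alpha : R) (b : nat) (g : R -> R) :
  (2 <= b)%N -> 0 < alpha -> one_periodic g -> lipschitz g ->
  bounded_measurable (weierstrass alpha b g).
Proof.
move=> b2 a0 pg lg.
have [C C0 gC] := one_periodic_lipschitz_bounded pg lg.
have cg := lipschitz_continuous_real lg.
have b0 : 0 < b%:R :> R by rewrite ltr0n (leq_trans _ b2).
pose x : R := b%:R `^ (- alpha).
have x0 : 0 < x by rewrite powR_gt0.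
have x1 : x < 1.
  have h : 1 `^ alpha < b%:R `^ alpha by rewrite gt0_ltr_powR// ?nnegrE// ltr1n.
  by rewrite /x powRN invf_lt1 ?powR_gt0//; move: h; rewrite powR1.
have x01 : 0 <= x < 1 by rewrite (ltW x0).
pose u k y : R := b%:R `^ (- (alpha * k%:R)) * g (b%:R ^+ k * y).
have uE k y : u k y = x ^+ k * g (b%:R ^+ k * y).
  by rewrite /u /x; congr (_ * _); rewrite -powR_mulrn ?powR_ge0// -powRrM mulNr.
(* The index is shifted because the series lemma sums from 1, whereas the Weierstrass series starts
   at 0. *)
pose h k := u k.-1.
have ha k y : `|h k y| <= C * x ^+ k.-1.
  by rewrite /h uE normrM ger0_norm ?exprn_ge0 ?(ltW x0)// mulrC ler_wpM2r ?exprn_ge0 ?(ltW x0).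
have hB n : \sum_(1 <= k < n) C * x ^+ k.-1 <= C * (1 - x)^-1.
  case: n => [|n]; first by rewrite big_geq// mulr_ge0// invr_ge0 subr_ge0 ltW.
  rewrite big_add1/= -mulr_sumr ler_wpM2l//; exact: geometric_sum_le.
have ch k : continuous (h k).
  have -> : h k = fun y => x ^+ k.-1 * g (b%:R ^+ k.-1 * y) by apply/funext => y; rewrite /h uE.
  have cm : continuous (fun y : R => b%:R ^+ k.-1 * y).
    by move=> y; apply: cvgMr; exact: cvg_id.
  by move=> y; apply: cvgMr; exact: (@continuous_comp R R R _ g y (cm y) (cg _)).
have [H cH hH] := summable_continuous_series ha hB ch.
have hH' y : \sum_(0 <= k < n) u k y @[n --> \oo] --> H y.
  by have := hH y; under eq_fun do rewrite big_add1/=.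
have WE : weierstrass alpha b g = H.
  by apply/funext => y; exact: (cvg_lim _ (hH' y)).
rewrite WE; split; first exact: continuous_measurable_fun.
exists (C * (1 - x)^-1) => y.
have hn : `|\sum_(1 <= k < n.+1) h k y| @[n --> \oo] --> `|H y|.
  by apply: cvg_norm; exact: hH.
rewrite -(cvg_lim _ hn)//; apply: limr_le; first exact: cvgP hn.
apply: nearW => n; apply: le_trans (hB n.+1); exact: norm_sum_series_le.
Qed.

(** In dimension 0 the sup norm is an empty maximum, hence 0, against the lower bound at the points
    [1/2] and [0]. *)
Lemma bi_holder_dim_gt0 (alpha : R) (d : nat) (Phi : R -> 'I_d -> R) :
  bi_holder alpha Phi -> (0 < d)%N.
Proof.
move=> [c1 [c2 [c10 [_ h]]]]; case: d Phi h => // Phi h.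
have [+ _] := h 2^-1 0; rewrite /sup_norm big_ord0 leNgt => /negP[].
rewrite mulr_gt0// powR_gt0// /circ_dist /fracpart subr0.
rewrite (_ : Num.floor _ = 0); last by apply: floor_def; rewrite /=; lra.
by rewrite subr0 lt_min; lra.
Qed.

End WeierstrassFunctions.

Theorem theorem3p2 (R : realType) (b d : nat) (alpha : R)
  (G : 'I_d -> R -> R) (g : R -> R) :
  (2 <= b)%N -> 0 < alpha -> alpha < 2^-1 ->
  (forall i, one_periodic (G i) /\ lipschitz (G i)) ->
  bi_holder alpha (weierstrass_map alpha b G) ->
  one_periodic g -> lipschitz g ->
  exists N : set ('I_d -> R), lebesgue_null N /\
    forall t : 'I_d -> R, ~ N t ->
      has_bdd_cont_density
        (fun x => weierstrass alpha b g x
                  + \sum_(i < d) t i * weierstrass_map alpha b G x i).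
Proof.
move=> b2 a0 a2 hG hPhi pg lg.
have d0 := bi_holder_dim_gt0 hPhi.
have bW := bounded_measurable_weierstrass b2 a0 pg lg.
have bPhi i : bounded_measurable (weierstrass alpha b (G i)).
  by have [pG lG] := hG i; exact: bounded_measurable_weierstrass.
have [mW [CW hCW]] := bW.
have mPhi i : measurable_fun setT (fun x => weierstrass_map alpha b G x i).
  by have [] := bPhi i.
have /choice[CP hCP] i : exists C : R, forall x, `|weierstrass alpha b (G i) x| <= C.
  by have [_] := bPhi i.
pose K := \sum_i CP i.
have CP0 i : 0 <= CP i by apply: le_trans (hCP i 0).
have PhiK x i : `|weierstrass_map alpha b G x i| <= K.
  by rewrite (le_trans (hCP i x))// /K (bigD1 i)//= lerDl sumr_ge0.
have [c1 [c2 [c10 [_ hc]]]] := hPhi.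
have lower x y := (hc x y).1.
eexists; split.
  exact: (null_not_fourier_summable d0 a0 c10 mW mPhi PhiK lower a2).
move=> t /= ht.
have bf : bounded_measurable (combination (weierstrass alpha b g) (weierstrass_map alpha b G) t).
  apply: bounded_measurableD => //; apply: bounded_measurable_sum => i.
  by apply: bounded_measurableZ; exact: bPhi.
have [mf [C fC]] := bf.
(* An integer with [C <= L / 2], available only once [t] is fixed; the null set was built for all
   [L]. *)
pose L := (Num.truncn (2 * C)).+1.
have fL x : `|combination (weierstrass alpha b g) (weierstrass_map alpha b G) t x| <= L%:R / 2.
  by rewrite (le_trans (fC x))// ler_pdivlMr// mulrC ltW// truncnS_gt.
have [B hB] : fourier_summable (combination (weierstrass alpha b g) (weierstrass_map alpha b G) t) L.
  by apply: contrapT => h; apply: ht; exists L.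
exact: has_bdd_cont_density_of_fourier mf fL hB.
Qed.
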